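(* For each $n\ge1$ let $x_n=(x_n(1),\ldots,x_n(n))$ be a deterministic sequence of positive numbers with empirical distribution function $E_n(x)=\frac1n\#\{i: x_n(i)\le x\}$. Suppose that for some probability distribution $F$ on $(0,\infty)$, $$\sup_x|E_n(x)-F(x)|\to0\qquad\text{as } n\to\infty .$$ For $u\in(0,1]$ let $E_{n,u}(\cdot)$ be the empirical distribution of the last $\lfloor nu\rfloor$ terms in a size-biased permutation of the sequence $x_n$. Let $\phi(y)=\int_0^\infty e^{-yx}F(dx)$, and let $F_u$ be the probability distribution $$F_u(dx)=\frac{e^{-x\phi^{-1}(u)}}{u}F(dx),\qquad u\in(0,1].$$ Then for each $\delta\in(0,1)$, $$\sup_{u\in[\delta,1]}\ \sup_{\mathbf I}\ |E_{n,u}(\mathbf I)-F_u(\mathbf I)|\longrightarrow0\quad\text{almost surely as } n\to\infty,$$ where $\mathbf I$ ranges over all subintervals of $(0,\infty)$.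
   Context: Size-biased permutation: for positive numbers $x(1),\ldots,x(n)$ with sum $t$, it is the sequence $(x(\sigma_1),\ldots,x(\sigma_n))$ where $\sigma$ is the random permutation with $\mathbb P(\sigma_1=i)=x(i)/t$ and, for distinct indices $i_1,\ldots,i_k$, $\mathbb P(\sigma_k=i_k\mid\sigma_1=i_1,\ldots,\sigma_{k-1}=i_{k-1})=\dfrac{x(i_k)}{t-(x(i_1)+\cdots+x(i_{k-1}))}$. The size-biased permutations for different $n$ are defined on a common probability space. $\phi^{-1}:(0,1]\to[0,\infty)$ is the inverse function of the Laplace transform $\phi$ (so $\phi^{-1}(1)=0$ and $F_1=F$). The empirical distribution of $m$ values is the probability measure giving mass $1/m$ to each; $E_{n,u}$ is considered for $n$ large enough that $\lfloor nu\rfloor\ge1$. *)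

(* Defs.v *)
From HB Require Import structures.
From mathcomp Require Import all_boot all_order all_algebra all_fingroup.
From mathcomp Require Import all_classical all_reals all_analysis.
Set Implicit Arguments.
Unset Strict Implicit.
Unset Printing Implicit Defensive.
Import Order.TTheory GRing.Theory Num.Theory.
Import numFieldNormedType.Exports.
Local Open Scope classical_set_scope.
Local Open Scope ring_scope.

(* Positions 1, ..., n are the elements 0, ..., n-1 of ['I_n], so that
   sigma_k is the value at the ordinal k-1. *)

Section Definitions.
Context {R : realType}.

Definition cond_prob d (Omega : measurableType d) (P : probability Omega R)
  (A B : set Omega) : R := fine (P (A `&` B)) / fine (P B).

(* For [k] the first position, the conditioning event is the whole space and
   the sum over earlier positions is empty, so that [size_biased_law] then
   reads P(sigma_1 = i) = x(i) / t.  All right-hand sides being positive when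
   [x] is, the law also forces the conditioning events to have positive
   probability (recall a / 0 = 0). *)
Record size_biased d (Omega : measurableType d) (P : probability Omega R)
    n (x : 'I_n -> R) (sigma : Omega -> 'S_n) : Prop := {
  size_biased_measurable :
    forall s : 'S_n, measurable [set w | sigma w = s] ;
  size_biased_law :
    forall (k : 'I_n) (i : 'I_n -> 'I_n),
      {in [pred l : 'I_n | (l <= k)%N] &, injective i} ->
      cond_prob P [set w | sigma w k = i k]
        [set w | forall l : 'I_n, (l < k)%N -> sigma w l = i l] =
      x (i k) / (\sum_(j < n) x j - \sum_(l < n | (l < k)%N) x (i l)) }.

Definition permuted_seq n (x : 'I_n -> R) (s : 'S_n) : seq R :=
  [seq x (s i) | i <- enum 'I_n].

Definition empirical_dist (s : seq R) (A : set R) : R :=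
  (count (fun y => y \in A) s)%:R / (size s)%:R.

Definition empirical_cdf n (x : 'I_n -> R) (a : R) : R :=
  #|[set i : 'I_n | x i <= a]%SET|%:R / n%:R.

Definition last_terms (m : nat) (s : seq R) : seq R := drop (size s - m) s.

(* [s] is meant to be the size-biased permutation of x_n; this is 0
   when floor(n u) = 0. *)
Definition tail_empirical (s : seq R) (u : R) (A : set R) : R :=
  empirical_dist (last_terms (Num.truncn ((size s)%:R * u)) s) A.

Definition laplace (F : probability (measurableTypeR R) R) (y : R) : R :=
  \int[F]_(x in `]0, +oo[) expR (- (y * x)).

(* [laplace F] is a bijection from [0, +oo[ to ]0, 1] when [F] lives on
   ]0, +oo[; outside of ]0, 1] the value is the junk value 0. *)
Definition laplace_inv (F : probability (measurableTypeR R) R) : R -> R :=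
  'pinv_(fun=> 0) `[0, +oo[ (laplace F).

Definition tilted (F : probability (measurableTypeR R) R) (u : R) (A : set R) :
    \bar R :=
  (\int[F]_(x in A) (expR (- (x * laplace_inv F u)) / u)%:E)%E.

End Definitions.

(* Main.v *)
Require Import Defs.
From HB Require Import structures.
From mathcomp Require Import all_boot all_order all_algebra all_fingroup.
From mathcomp Require Import all_classical all_reals all_analysis.
From mathcomp Require Import measurable_realfun ring lra.
Import Order.TTheory GRing.Theory Num.Theory.
Import numFieldNormedType.Exports.
Local Open Scope classical_set_scope.
Local Open Scope ring_scope.

(** If the items carried independent exponential clocks of rates x(i), their
    order of removal would be size-biased and the set of survivors at time y
    would be a family of independent events of probabilities exp(- y x(i)).
    This embedding is replaced by a time read off the permutation itself:
    after k removals, the clock shows the sum of 1/T_j over j < k, where T_j is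
    the weight left after j removals.  For c > 0, the product of the factors
    1 + c exp(- x(i) (y - clock)) over the survivors i in a set A is exactly a
    supermartingale (by convexity of the logarithm of each factor in the time
    and 1 + z <= exp z), so that it gives, on the event that the clock has
    passed y, the Chernoff bound of the independent case for the number of
    survivors in A.  The product of the factors 1 - c exp(- u x(i) (y - clock)),
    with u > 1, shows in the same way that the clock is not late.  The total
    number of survivors being deterministic, upper bounds for A and for its
    complement are enough.

    The failure probabilities are exponentially small in n, which allows a
    union bound over the n + 1 traces of initial segments on x_n and
    Borel-Cantelli for fixed u.  Uniformity in u comes from a finite grid, since
    u F_u(A) is nondecreasing and 1-Lipschitz in u. *)

Set Implicit Arguments.
Unset Strict Implicit.
Unset Printing Implicit Defensive.

(** * Bounds on the exponential function *)

Section ExponentialBounds.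
Context {R : realType}.
Implicit Types c h q t u z : R.

Lemma expR_le_quad t : 0 <= t -> t <= 2^-1 -> expR t <= 1 + t + 2 * t ^+ 2.
Proof.
move=> t0 t1; have t1' : 0 < 1 - t by lra.
have := expR_ge1Dx (- t); rewrite expRN => le_t.
have : expR t <= (1 - t)^-1.
  by rewrite -[expR t]invrK lef_pV2// posrE ?invr_gt0 ?expR_gt0.
move=> /le_trans; apply; rewrite -div1r ler_pdivrMr//; nra.
Qed.

Lemma expRN_le_quad t : 0 <= t -> expR (- t) <= 1 - t + t ^+ 2.
Proof.
move=> t0; rewrite expRN.
have : (expR t)^-1 <= (1 + t)^-1.
  by rewrite lef_pV2 ?posrE ?expR_gt0 ?expR_ge1Dx//; lra.
move=> /le_trans; apply; rewrite -div1r ler_pdivrMr; last by lra.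
have : 0 <= t ^+ 3 by rewrite exprn_ge0.
by rewrite !exprS expr0; nra.
Qed.

Lemma expRN_le_subr c : 0 <= c -> c <= 2^-1 ->
  expR (- (c + 2 * c ^+ 2)) <= 1 - c.
Proof.
move=> c0 c1; have c1' : 0 < 1 - c by lra.
rewrite expRN -[leRHS]invrK lef_pV2 ?posrE ?invr_gt0 ?expR_gt0//.
rewrite (le_trans _ (expR_ge1Dx _))// -div1r ler_pdivrMr//; nra.
Qed.

(* Tangents to exp at [- q h] bound [exp (- h)] and [1 = exp 0] from below. *)
Lemma expR_convex_weight q h : 0 <= q -> q <= 1 ->
  expR (- (q * h)) <= 1 - q + q * expR (- h).
Proof.
move=> q0 q1; set E := expR (- (q * h)).
have E0 : 0 < E by exact: expR_gt0.
have E1 : E * (1 + q * h) <= 1.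
  have : E * expR (q * h) <= 1 by rewrite -expRD addNr expR0.
  by apply: le_trans; rewrite ler_pM2l// expR_ge1Dx.
have Eh : E * (1 - h + q * h) <= expR (- h).
  have -> : expR (- h) = E * expR (- h + q * h).
    by rewrite -expRD; congr expR; ring.
  by rewrite ler_pM2l// -addrA expR_ge1Dx.
nra.
Qed.

(** As a function of [h], log (1 + z exp (- h)) is convex, and its tangent at 0 has slope - z / (1 +
    z), that is (1 + z)^-1 - 1. *)
Lemma upper_factor z h : 0 <= z ->
  (1 + z) * expR (h * ((1 + z)^-1 - 1)) <= 1 + z * expR (- h).
Proof.
move=> z0; have z1 : 0 < 1 + z by lra.
have -> : h * ((1 + z)^-1 - 1) = - (z / (1 + z) * h) by field; rewrite gt_eqF.
have := @expR_convex_weight (z / (1 + z)) h.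
rewrite divr_ge0// ?(ltW z1)// ler_pdivrMr// mul1r lerDr ler01.
move=> /(_ isT isT); rewrite -(ler_pM2l z1) => /le_trans; apply.
by rewrite le_eqVlt; apply/orP; left; apply/eqP; field; rewrite gt_eqF.
Qed.

(** Dividing by 1 - z leaves exp (h q) against 1 + q (1 - exp (- u h)), where q = z / (1 - z) is at
    most 1. To first order these are 1 + h q and 1 + u h q; the gap u - 1 absorbs the quadratic
    errors of both exponentials. *)
Lemma lower_factor z h u : 0 <= z -> z <= 2^-1 -> 0 <= h -> 1 <= u ->
  h * (2 + u ^+ 2) <= u - 1 ->
  (1 - z) * expR (h * ((1 - z)^-1 - 1)) <= 1 - z * expR (- (u * h)).
Proof.
move=> z0 z1 h0 u1 hu; have z1' : 0 < 1 - z by lra.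
set q := (1 - z)^-1 - 1.
have zq : z = q * (1 - z) by rewrite /q; field; rewrite gt_eqF.
have q0 : 0 <= q by rewrite -(pmulr_lge0 _ z1') -zq.
have q1 : q <= 1 by rewrite -(ler_pM2r z1') -zq; lra.
have h1 : h <= 2^-1.
  rewrite -(@ler_pM2r _ (2 + u ^+ 2)); last by nra.
  by rewrite (le_trans hu)//; nra.
have hq : expR (h * q) <= 1 + h * q + 2 * (h * q) ^+ 2.
  by apply: expR_le_quad; nra.
have uh : expR (- (u * h)) <= 1 - u * h + (u * h) ^+ 2.
  by apply: expRN_le_quad; nra.
have le_q : expR (h * q) <= 1 + q * (1 - expR (- (u * h))).
  rewrite (le_trans hq)//.
  have : q * (h + 2 * h ^+ 2) <= q * (1 - expR (- (u * h))).
    rewrite ler_wpM2l//.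
    have : h * (h * (2 + u ^+ 2)) <= h * (u - 1) by rewrite ler_wpM2l.
    by nra.
  have : q * q * h ^+ 2 <= q * 1 * h ^+ 2.
    by rewrite ler_wpM2r ?sqr_ge0// ler_wpM2l.
  by nra.
have -> : 1 - z * expR (- (u * h)) =
          (1 - z) * (1 + q * (1 - expR (- (u * h)))).
  rewrite mulrDr mulrA [_ * q]mulrC -zq; ring.
by rewrite ler_pM2l.
Qed.

End ExponentialBounds.

(** * Size-biased removal *)

Section SequentialSampling.
Context {R : realType} {n : nat}.
Variable x : 'I_n -> R.
Implicit Types (s : 'S_n) (j k m : nat) (W : 'S_n -> R) (B : pred 'S_n).

Definition rest_weight s j : R := \sum_(l < n | (j <= l)%N) x (s l).

Definition clock s j : R := \sum_(l < n | (l < j)%N) (rest_weight s l)^-1.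

(** The probability that a size-biased permutation agrees with [s] at its first [j] positions; see
    [prefix_event_prob]. *)
Definition prefix_prob s j : R :=
  \prod_(l < n | (l < j)%N) (x (s l) / rest_weight s l).

Definition perm_prob B : R := \sum_(s | B s) prefix_prob s n.

Lemma leq_tperm (a b i : 'I_n) m :
  (m <= a)%N -> (m <= b)%N -> (m <= tperm a b i)%N = (m <= i)%N.
Proof. by move=> ma mb; case: tpermP => // ->; rewrite ma mb. Qed.

Lemma tperm_lt (a b i : 'I_n) : (i < a)%N -> (a <= b)%N -> tperm a b i = i.
Proof.
move=> ia ab; rewrite tpermD//; apply/eqP => e.
  by move: ia; rewrite -e ltnn.
by move: ia; rewrite -e ltnNge ab.
Qed.

Lemma big_rest_tperm (T : Type) (idx : T) (op : Monoid.com_law idx)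
    (f : 'I_n -> T) s (a b : 'I_n) m : (m <= a)%N -> (a <= b)%N ->
  \big[op/idx]_(l < n | (m <= l)%N) f ((tperm a b * s)%g l) =
  \big[op/idx]_(l < n | (m <= l)%N) f (s l).
Proof.
move=> ma ab; rewrite [RHS](reindex_inj (@perm_inj _ (tperm a b))).
apply: eq_big => l; last by rewrite permM.
by rewrite leq_tperm// (leq_trans ma).
Qed.

Lemma rest_weight_tperm s (a b : 'I_n) m : (m <= a)%N -> (a <= b)%N ->
  rest_weight (tperm a b * s)%g m = rest_weight s m.
Proof. exact: big_rest_tperm. Qed.

(** The clock is predictable, hence the bound [a.+1] and not [a]: its increment at a removal is the
    inverse of the weight present before that removal, whichever item is then taken. *)
Lemma clock_tperm s (a b : 'I_n) m : (m <= a.+1)%N -> (a <= b)%N ->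
  clock (tperm a b * s)%g m = clock s m.
Proof.
move=> ma ab; apply: eq_bigr => l lm.
by rewrite rest_weight_tperm// -ltnS (leq_trans lm).
Qed.

Lemma prefix_prob_tperm s (a b : 'I_n) m : (m <= a)%N -> (a <= b)%N ->
  prefix_prob (tperm a b * s)%g m = prefix_prob s m.
Proof.
move=> ma ab; apply: eq_bigr => l lm; have la := leq_trans lm ma.
by rewrite rest_weight_tperm// ?permM ?tperm_lt// ltnW.
Qed.

Lemma big_ltnS_ord (T : Type) (idx : T) (op : Monoid.com_law idx)
    (a : 'I_n) (f : 'I_n -> T) :
  \big[op/idx]_(l < n | (l < a.+1)%N) f l =
  op (\big[op/idx]_(l < n | (l < a)%N) f l) (f a).
Proof.
rewrite (bigD1 a)//= Monoid.mulmC; congr (op _ _); apply: eq_bigl => l.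
by rewrite ltnS [(l < a)%N]ltn_neqAle andbC.
Qed.

Lemma prefix_probS s (a : 'I_n) :
  prefix_prob s a.+1 = prefix_prob s a * (x (s a) / rest_weight s a).
Proof. exact: big_ltnS_ord. Qed.

Lemma clockS s (a : 'I_n) : clock s a.+1 = clock s a + (rest_weight s a)^-1.
Proof. exact: big_ltnS_ord. Qed.

Lemma clock0 s : clock s 0 = 0.
Proof. by rewrite /clock big_pred0. Qed.

Lemma card_ge_ord m : #|[pred l : 'I_n | (m <= l)%N]| = (n - m)%N.
Proof.
rewrite -sum1_card -(big_mkord (fun l => m <= l)%N (fun=> 1%N)).
have := sum_nat_const_nat m n 1; rewrite muln1 => <-.
by rewrite (big_nat_widenl m 0).
Qed.

(* Moving each survivor in turn to position [a] plays the role of summing over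
   the extensions of a prefix of length [a]. *)
Lemma sum_perm_tperm (g : 'S_n -> R) (a : 'I_n) :
  \sum_s \sum_(l : 'I_n | (a <= l)%N) g (tperm a l * s)%g =
  (\sum_s g s) *+ (n - a).
Proof.
rewrite exchange_big/=.
rewrite (eq_bigr (fun=> \sum_s g s)); last first.
  by move=> l _; rewrite [RHS](reindex_inj (mulgI (tperm a l))).
by rewrite sumr_const card_ge_ord.
Qed.

Hypothesis x_gt0 : forall i, 0 < x i.

Lemma rest_weight_ge0 s j : 0 <= rest_weight s j.
Proof. by apply: sumr_ge0 => l _; exact: ltW. Qed.

Lemma rest_weight_gt0 s (a : 'I_n) : 0 < rest_weight s a.
Proof.
rewrite /rest_weight (bigD1 a)//= ltr_pwDl//.
by apply: sumr_ge0 => l _; exact: ltW.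
Qed.

Lemma prefix_prob_ge0 s j : 0 <= prefix_prob s j.
Proof.
by apply: prodr_ge0 => l _; rewrite divr_ge0// ?rest_weight_ge0// ltW.
Qed.

(** One step of a supermartingale. A sum over [s] counts each prefix of length j as many as (n - j)!
    times; the factor [n - a] makes up for the change of this multiplicity from length a to a +
    1. *)
Lemma prefix_prob_step (a : 'I_n) W W' :
  (forall s, \sum_(l : 'I_n | (a <= l)%N) x (s l) * W' (tperm a l * s)%g <=
             rest_weight s a * W s) ->
  (\sum_s prefix_prob s a.+1 * W' s) *+ (n - a) <=
  \sum_s prefix_prob s a * W s.
Proof.
move=> WW'; rewrite -sum_perm_tperm; apply: ler_sum => s _.
have -> : \sum_(l : 'I_n | (a <= l)%N) prefix_prob (tperm a l * s)%g a.+1 *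
    W' (tperm a l * s)%g = prefix_prob s a / rest_weight s a *
    \sum_(l : 'I_n | (a <= l)%N) x (s l) * W' (tperm a l * s)%g.
  rewrite mulr_sumr; apply: eq_bigr => l al.
  rewrite prefix_probS prefix_prob_tperm// rest_weight_tperm// permM tpermL.
  by ring.
rewrite -mulrA ler_wpM2l ?prefix_prob_ge0// ler_pdivrMl ?rest_weight_gt0//.
Qed.

(* The third hypothesis says that [V k s] depends only on the first [k] values
   of [s]. *)
Lemma prefix_prob_supermartingale (V : nat -> 'S_n -> R) k (v : R) :
  (k <= n)%N ->
  (forall (a : 'I_n) s, (a < k)%N ->
     \sum_(l : 'I_n | (a <= l)%N) x (s l) * V a.+1 (tperm a l * s)%g <=
     rest_weight s a * V a s) ->
  (forall (a b : 'I_n) s, (k <= a)%N -> (a <= b)%N ->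
     V k (tperm a b * s)%g = V k s) ->
  (forall s, V 0 s = v) ->
  \sum_s prefix_prob s n * V k s <= v.
Proof.
move=> kn V_step V_meas V0.
(* The process is stopped after [k] removals; from then on it is constant along the steps by the
   third hypothesis. *)
pose W j := V (minn j k).
have W_step (a : 'I_n) :
    (\sum_s prefix_prob s a.+1 * W a.+1 s) *+ (n - a) <=
    \sum_s prefix_prob s a * W a s.
  apply: prefix_prob_step => s; rewrite /W; case: (ltnP a k) => [ak|ka].
    by rewrite (minn_idPl ak) V_step.
  rewrite (minn_idPr (leqW ka)) /rest_weight mulr_suml.
  by apply: ler_sum => l al; rewrite V_meas.
(* The factorial is the number of permutations sharing a prefix of length [j]; it is n! at the start
   and 1 at the end. *)
have W_le j : (j <= n)%N ->
    \sum_s prefix_prob s j * W j s <= v *+ (n - j)`!.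
  elim: j => [_|j IH jn].
    rewrite subn0 (eq_bigr (fun=> v)); last first.
      by move=> s _; rewrite /W min0n V0 /prefix_prob big_pred0 ?mul1r.
    by rewrite sumr_const -card_Sn.
  have := le_trans (W_step (Ordinal jn)) (IH (ltnW jn)).
  rewrite /= -(subnSK jn) factS mulnC mulrnA lerMn2r => /orP[|//].
  by rewrite eqn0Ngt.
have := W_le n (leqnn n).
by rewrite subnn mulr1n /W (minn_idPr kn).
Qed.

Lemma big_rest_tpermS (T : Type) (idx : T) (op : Monoid.com_law idx)
    (f : 'I_n -> T) s (a b : 'I_n) : (a <= b)%N ->
  op (f (s b)) (\big[op/idx]_(l < n | (a < l)%N) f ((tperm a b * s)%g l)) =
  \big[op/idx]_(l < n | (a <= l)%N) f (s l).
Proof.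
move=> ab; rewrite -(big_rest_tperm _ _ _ (leqnn a) ab) [RHS](bigD1 a)//=.
rewrite permM tpermL; congr (op _ _); apply: eq_bigl => l.
by rewrite ltn_neqAle andbC eq_sym.
Qed.

(** Removing item i, which has probability x i / T, divides the product of [G] over the survivors by
    [G i]. The mean is therefore the old product times 1 + sum of (x i / T) (1 / G i - 1), and 1 + z
    <= exp z turns this into a product with one factor per survivor. *)
Lemma removal_step s (a : 'I_n) (G H : 'I_n -> R) (T := rest_weight s a) :
  (forall i, 0 < G i) ->
  (forall i, G i * expR (x i / T * ((G i)^-1 - 1)) <= H i) ->
  \sum_(l : 'I_n | (a <= l)%N)
    x (s l) * \prod_(l' < n | (a < l')%N) G ((tperm a l * s)%g l') <=
  T * \prod_(l < n | (a <= l)%N) H (s l).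
Proof.
move=> G_gt0 GH; have T_gt0 : 0 < T by exact: rest_weight_gt0.
set PG := \prod_(l < n | (a <= l)%N) G (s l).
have PG_gt0 : 0 < PG by exact: prodr_gt0.
have sum1 : \sum_(l : 'I_n | (a <= l)%N) x (s l) / T = 1.
  by rewrite -mulr_suml divff ?gt_eqF.
have -> : \sum_(l : 'I_n | (a <= l)%N)
    x (s l) * \prod_(l' < n | (a < l')%N) G ((tperm a l * s)%g l') =
    T * (PG * (\sum_(l : 'I_n | (a <= l)%N) x (s l) / T +
      \sum_(l : 'I_n | (a <= l)%N) x (s l) / T * ((G (s l))^-1 - 1))).
  rewrite -big_split/= mulrA mulr_sumr; apply: eq_bigr => l al.
  rewrite /PG -(big_rest_tpermS _ G s al)/=.
  set P := \prod_(_ < n | _) _.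
  by field; rewrite !gt_eqF.
rewrite sum1 ler_pM2l//.
apply: (@le_trans _ _ (PG * expR (\sum_(l : 'I_n | (a <= l)%N)
      x (s l) / T * ((G (s l))^-1 - 1)))).
  by rewrite ler_pM2l// expR_ge1Dx.
rewrite expR_sum -big_split/=; apply: ler_prod => l _.
by rewrite GH andbT mulr_ge0// ?expR_ge0// ltW.
Qed.

(** The argument [r] of [g i] is the time left before [y]. The predicate [D] holds the clock values
    at which the factors are under control: all of them for the upper tail, those up to [y] for the
    lower tail. *)
Lemma product_supermartingale (g : 'I_n -> R -> R) (y : R) (D : pred R) k :
  (k <= n)%N -> D 0 ->
  (forall i r, D (y - r) -> 0 < g i r) ->
  (forall (a : 'I_n) s (T := rest_weight s a) (r := y - clock s a.+1),
    (a < k)%N -> D (y - r) -> D (y - (r + T^-1)) /\ forall i,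
    g i r * expR (x i / T * ((g i r)^-1 - 1)) <= g i (r + T^-1)) ->
  \sum_s prefix_prob s n * ((D (clock s k))%:R *
    \prod_(l < n | (k <= l)%N) g (s l) (y - clock s k)) <= \prod_i g i y.
Proof.
move=> kn D0 g_gt0 g_step.
pose V j s := (D (clock s j))%:R *
  \prod_(l < n | (j <= l)%N) g (s l) (y - clock s j).
apply: (@prefix_prob_supermartingale V) => //.
- move=> a s ak; rewrite /V.
  (* Since the next clock value is the same for every removed item, leaving [D] makes the whole mean
     vanish. *)
  have [Da|nDa] := boolP (D (clock s a.+1)); last first.
    rewrite big1 => [|l al].
      apply: mulr_ge0; first exact: rest_weight_ge0.
      case: (boolP (D (clock s a))) => Da; last by rewrite mul0r.
      by rewrite mul1r prodr_ge0// => l _; rewrite ltW// g_gt0// subKr.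
    by rewrite clock_tperm// (negbTE nDa) mul0r mulr0.
  have e : y - clock s a.+1 + (rest_weight s a)^-1 = y - clock s a.
    by rewrite clockS; ring.
  have [] := g_step a s ak; first by rewrite subKr.
  rewrite e subKr => -> stp; rewrite mul1r.
  rewrite (le_trans _ (removal_step _ stp))//.
    rewrite le_eqVlt; apply/orP; left; apply/eqP.
    by apply: eq_bigr => l al; rewrite clock_tperm// Da mul1r.
  by move=> i; rewrite g_gt0// subKr.
- move=> a b s ka ab; rewrite /V clock_tperm ?(leqW ka)//.
  by rewrite (big_rest_tperm _ (fun i => g i (y - clock s k))).
- move=> s; rewrite /V clock0 D0 mul1r subr0.
  by rewrite [RHS](reindex_inj (@perm_inj _ s)).
Qed.

(** * Chernoff bounds for the number of survivors in a set *)

Definition kept (A : pred 'I_n) s k : R :=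
  \sum_(l < n | (k <= l)%N) (A (s l))%:R.

Lemma perm_prob_markov B (V : 'S_n -> R) (w v : R) :
  0 < w -> (forall s, 0 <= V s) -> (forall s, B s -> w <= V s) ->
  \sum_s prefix_prob s n * V s <= v -> perm_prob B <= v / w.
Proof.
move=> w0 V0 wV Vv; rewrite ler_pdivlMr//; apply: le_trans Vv.
rewrite /perm_prob mulr_suml [leRHS](bigID B)/= ler_wpDr//.
  by apply: sumr_ge0 => s _; rewrite mulr_ge0 ?prefix_prob_ge0.
by apply: ler_sum => s Bs; rewrite ler_wpM2l ?prefix_prob_ge0 ?wV.
Qed.

(** Once the clock has passed [y], each survivor in [A] has a factor at least 1 + c = [expR t], so
    that the product is at least [expR (t * m)] on the event; at clock 0 the product is bounded
    through 1 + z <= exp z. *)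
Lemma upper_tail (A : pred 'I_n) (y t m : R) k (c := expR t - 1) :
  (k <= n)%N -> 0 <= t ->
  perm_prob [pred s | (y <= clock s k) && (m <= kept A s k)] <=
  expR (c * (\sum_(i | A i) expR (- (x i * y))) - t * m).
Proof.
move=> kn t0; have c0 : 0 <= c by rewrite subr_ge0 -[leLHS]expR0 ler_expR.
pose z i r := (A i)%:R * c * expR (- (x i * r)).
have z0 i r : 0 <= z i r by rewrite !mulr_ge0 ?expR_ge0.
have z1 i r : 0 < 1 + z i r by rewrite ltr_wpDr.
have /= V_le := @product_supermartingale (fun i r => 1 + z i r) y predT k
  kn isT (fun i r _ => z1 i r).
have {}V_le := V_le _.
apply: le_trans (perm_prob_markov (expR_gt0 (t * m)) _ _ (V_le _)) _.
- move=> s; by rewrite mul1r prodr_ge0// => l _; rewrite addr_ge0.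
- move=> s /andP[yk mk].
  rewrite mul1r (@le_trans _ _ (expR (t * kept A s k)))//.
    by rewrite ler_expR ler_wpM2l.
  rewrite /kept mulr_sumr expR_sum; apply: ler_prod => l _; rewrite expR_ge0/=.
  rewrite /z; case: (A (s l)); rewrite ?mulr1 ?mulr0 ?expR0 ?mul0r ?addr0//.
  rewrite mul1r -[leLHS](subrKC 1) lerD2l ler_peMr// -[leLHS]expR0 ler_expR.
  by rewrite -mulrN mulr_ge0 ?opprB ?subr_ge0 ?(ltW (x_gt0 _)).
- move=> a s ak; split=> // i; rewrite (le_trans (upper_factor _ _))//.
  rewrite /z; move: (y - clock s a.+1) => r.
  by rewrite [x i * (_ + _)]mulrDr opprD expRD mulrA.
rewrite expRD expRN ler_pM2r ?invr_gt0 ?expR_gt0//.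
rewrite mulr_sumr expR_sum [leRHS]big_mkcond/=; apply: ler_prod => i _.
rewrite addr_ge0//= /z; case: (A i); last by rewrite !mul0r addr0.
by rewrite mul1r expR_ge1Dx.
Qed.

(* The factors [1 - c exp (- u x r)] are concave in [r], so that the clock has
   to run slightly too fast ([u > 1]) and the removal probabilities of the
   elements of [A] have to be small. *)
Lemma lower_tail (A : pred 'I_n) (y u c m : R) k :
  (k <= n)%N -> 0 <= y -> 1 <= u -> 0 <= c -> c <= 2^-1 ->
  (forall (a : 'I_n) s i, (a < k)%N -> A i ->
     x i / rest_weight s a * (2 + u ^+ 2) <= u - 1) ->
  perm_prob [pred s | (clock s k <= y) && (kept A s k <= m)] <=
  expR ((c + 2 * c ^+ 2) * m - c * \sum_(i | A i) expR (- (u * x i * y))).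
Proof.
move=> kn y0 u1 c0 c1 small.
pose z i r := (A i)%:R * c * expR (- (u * x i * r)).
have z0 i r : 0 <= z i r by rewrite !mulr_ge0 ?expR_ge0.
have zc i r : 0 <= r -> z i r <= (A i)%:R * c.
  move=> r0; rewrite ler_piMr ?mulr_ge0// -[leRHS]expR0 ler_expR oppr_le0.
  by rewrite !mulr_ge0 ?(ltW (x_gt0 _))// (le_trans ler01).
have zh i r : 0 <= r -> z i r <= 2^-1.
  by move=> r0; rewrite (le_trans (zc _ _ r0))//; case: (A i) => /=; lra.
have z1 i r : 0 <= r -> 0 < 1 - z i r by move=> /(zh i r); lra.
have zy i r : y - r <= y -> 0 < 1 - z i r by move=> yr; rewrite z1//; lra.
have /= V_le := @product_supermartingale (fun i r => 1 - z i r) y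
  [pred v | v <= y] k kn y0 zy.
have {}V_le := V_le _.
apply: le_trans (perm_prob_markov
  (expR_gt0 (- ((c + 2 * c ^+ 2) * m))) _ _ (V_le _)) _; last 2 first.
- move=> a s ak /=.
  have T0 : 0 < (rest_weight s a)^-1 by rewrite invr_gt0 rest_weight_gt0.
  move=> yr; have r0 : 0 <= y - clock s a.+1 by lra.
  split=> [|i]; first by lra.
  have [Ai|nAi] := boolP (A i); last first.
    by rewrite /z (negbTE nAi) !mul0r !subr0 invr1 subrr mulr0 expR0 mulr1.
  rewrite (le_trans (lower_factor _ _ _ u1 (small _ _ _ ak Ai)))// ?zh//.
    by rewrite divr_ge0 ?rest_weight_ge0// ltW.
  rewrite /z; move: (y - clock s a.+1) => r.
  by rewrite [_ * x i * (_ + _)]mulrDr opprD expRD !mulrA.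
- rewrite expRD -expRN opprK mulrC ler_pM2l ?expR_gt0//.
  rewrite -mulrN -sumrN mulr_sumr expR_sum [leRHS]big_mkcond/=.
  apply: ler_prod => i _; rewrite ltW ?z1//= /z; case: (A i); last first.
    by rewrite !mul0r subr0.
  by rewrite mul1r mulrN expR_ge1Dx.
- move=> s; have [yk|] := leP (clock s k) y; last by rewrite mul0r.
  by rewrite mul1r prodr_ge0// => l _; rewrite ltW// z1// subr_ge0.
(* While the clock is at most [y], the factor of a survivor in [A] is at least 1 - c, hence at least
   exp (- (c + 2 c^2)), and at most [m] such factors occur. *)
- move=> s /andP[yk mk]; rewrite yk mul1r.
  rewrite (@le_trans _ _ (expR (- (c + 2 * c ^+ 2) * kept A s k)))//.
    rewrite ler_expR mulNr lerN2 ler_wpM2l// addr_ge0 ?mulr_ge0 ?sqr_ge0//.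
  rewrite /kept mulr_sumr expR_sum; apply: ler_prod => l _; rewrite expR_ge0/=.
  have := zc (s l) (y - clock s k); rewrite subr_ge0 => /(_ yk).
  case: (A (s l)) => /=; rewrite ?mulr1 ?mulr0 ?mul0r ?mul1r ?expR0;
    last by lra.
  by have := expRN_le_subr c0 c1; lra.
Qed.

End SequentialSampling.

(** * From the law of a size-biased permutation to weights of permutations *)

Section SizeBiasedLaw.
Context {R : realType} {d : measure_display} {Omega : measurableType d}.
Context {P : probability Omega R} {n : nat} {x : 'I_n -> R}.
Context {sigma : Omega -> 'S_n}.
Hypotheses (x_gt0 : forall i, 0 < x i) (sb : size_biased P x sigma).

Lemma measurable_perm_event (B : pred 'S_n) :
  measurable [set w | B (sigma w)].
Proof.
have -> : [set w | B (sigma w)] =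
    \bigcup_(s in [set s | B s]) [set w | sigma w = s].
  apply/seteqP; split => w /=; first by move=> Bw; exists (sigma w).
  by move=> [s Bs ->].
apply: fin_bigcup_measurable => [|s _]; first exact: finite_finset.
 exact: size_biased_measurable sb s.
Qed.

Lemma prefix_prob_gt0 (s : 'S_n) j : 0 < prefix_prob x s j.
Proof. by apply: prodr_gt0 => l _; rewrite divr_gt0 ?rest_weight_gt0. Qed.

(** Chain rule for the conditional probabilities: the denominator in [size_biased_law], total weight
    minus removed weight, is [rest_weight]. *)
Lemma prefix_event_prob (s : 'S_n) k : (k <= n)%N ->
  fine (P [set w | forall l : 'I_n, (l < k)%N -> sigma w l = s l]) =
  prefix_prob x s k.
Proof.
elim: k => [_|k IH kn].
  rewrite /prefix_prob big_pred0//.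
  rewrite (_ : [set w | _] = setT) ?probability_setT//.
  by apply/seteqP; split.
have /= := size_biased_law sb (k := Ordinal kn) (i := s).
rewrite /cond_prob IH ?(ltnW kn)// => law.
rewrite -[k.+1]/((Ordinal kn).+1) prefix_probS.
have -> : [set w | forall l : 'I_n, (l < (Ordinal kn).+1)%N -> sigma w l = s l]
    = [set w | sigma w (Ordinal kn) = s (Ordinal kn)] `&`
      [set w | forall l : 'I_n, (l < k)%N -> sigma w l = s l].
  apply/seteqP; split => w /=.
    by move=> H; split=> [|l lk]; apply: H; rewrite // ltnW.
  move=> [H1 H2] l; rewrite ltnS leq_eqVlt => /predU1P[lk|]; last exact: H2.
  by rewrite (_ : l = Ordinal kn) //; exact: val_inj.
apply: (@mulIf _ (prefix_prob x s k)^-1).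
  by rewrite invr_eq0 gt_eqF// prefix_prob_gt0.
rewrite law; last by move=> ? ? _ _; exact: perm_inj.
rewrite mulrAC divff ?gt_eqF ?prefix_prob_gt0// mul1r.
congr (_ / _); rewrite [X in X - _](reindex_inj (@perm_inj _ s))/=.
rewrite [X in X - _](bigID (fun j : 'I_n => (j < k)%N))/=.
rewrite [X in X - _]addrC addrK.
by apply: eq_bigl => l; rewrite -leqNgt.
Qed.

(** Finite subadditivity over the permutations in [B], each of which is the event of a full
    prefix. *)
Lemma perm_event_le (B : pred 'S_n) :
  (P [set w | B (sigma w)] <= (perm_prob x B)%:E)%E.
Proof.
have P_eq s : P [set w | sigma w = s] = (prefix_prob x s n)%:E.
  rewrite -prefix_event_prob// fineK; last first.
    apply: fin_num_measure.
    rewrite (_ : [set w | _] = [set w | [pred s' : 'S_n |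
      [forall l : 'I_n, (l < n)%N ==> (s' l == s l)]] (sigma w)]).
      exact: measurable_perm_event.
    apply/seteqP; split => w /=.
      by move=> H; apply/forallP => l; apply/implyP => /H/eqP.
    by move=> /forallP H l ln; apply/eqP; have /implyP := H l; exact.
  congr (P _); apply/seteqP; split => w /=; first by move=> ->.
  by move=> H; apply/permP => l; exact: H.
suff le_seq (r : seq 'S_n) : uniq r ->
    (P [set w | sigma w \in r] <= (\sum_(s <- r) prefix_prob x s n)%:E)%E.
  have -> : [set w | B (sigma w)] = [set w | sigma w \in enum B].
    by apply/seteqP; split => w /=; rewrite mem_enum.
  by have := le_seq (enum B) (enum_uniq _); rewrite big_enum.
elim: r => [_|s r IH /andP[_ /IH{}IH]].
  by rewrite big_nil (_ : [set w | _] = set0) ?measure0//; apply/seteqP; split.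
rewrite big_cons EFinD -P_eq (le_trans _ (leeD2l _ IH))//.
have -> : [set w | sigma w \in s :: r] =
    [set w | sigma w = s] `|` [set w | sigma w \in r].
  apply/seteqP; split => w /=; rewrite inE => /predU1P//.
apply: measureU2; last exact: (measurable_perm_event [pred s | s \in r]).
exact: size_biased_measurable sb s.
Qed.

End SizeBiasedLaw.

(** * Laplace transform and tilted measures *)

Section TiltedMass.
Context {R : realType} (F : probability (measurableTypeR R) R).
Implicit Types (y u : R) (A : set R).
Local Notation pos := `]0 : R, +oo[%classic.

Definition tilted_mass y A : R := \int[F]_(x in A) expR (- (y * x)).

Lemma measurable_expRNM y A : measurable_fun A (fun x : R => expR (- (y * x))).
Proof.
apply: measurableT_comp; first exact: measurable_expR.
apply: measurableT_comp => //; exact: measurable_funM.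
Qed.

Lemma expRNM_le1 y x : 0 <= y -> 0 <= x -> expR (- (y * x)) <= 1.
Proof. by move=> y0 x0; rewrite expR_le1 oppr_le0 mulr_ge0. Qed.

Lemma integrable_expRNM y A : 0 <= y -> measurable A -> A `<=` pos ->
  F.-integrable A (fun x => (expR (- (y * x)))%:E).
Proof.
move=> y0 mA Apos; apply: (@le_integrable _ _ _ F A mA _ (EFin \o cst 1)).
- by apply/measurable_EFinP; exact: measurable_expRNM.
- move=> x /Apos /=; rewrite in_itv/= andbT => x0.
  by rewrite lee_fin !ger0_norm ?expR_ge0// expRNM_le1// ltW.
- exact: finite_measure_integrable_cst.
Qed.

Lemma tilted_massU y A A' : 0 <= y -> measurable A -> measurable A' ->
  A `<=` pos -> A' `<=` pos -> [disjoint A & A'] ->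
  tilted_mass y (A `|` A') = tilted_mass y A + tilted_mass y A'.
Proof.
move=> y0 mA mA' Ap Ap' AA'; apply: Rintegral_setU => //.
by apply: integrable_expRNM => //; [exact: measurableU|rewrite subUset].
Qed.

Lemma tilted_mass_nincr y y' A : 0 <= y -> y <= y' -> measurable A ->
  A `<=` pos -> tilted_mass y' A <= tilted_mass y A.
Proof.
move=> y0 yy' mA Ap; apply: le_Rintegral => //.
- by apply: integrable_expRNM => //; exact: le_trans yy'.
- exact: integrable_expRNM.
- move=> x /Ap /=; rewrite in_itv/= andbT => x0.
  by rewrite ler_expR lerN2 ler_wpM2r// ltW.
Qed.

(** The mass of the complement of [A] in the half-line decreases too, so [A] cannot lose more than
    the whole half-line does. *)
Lemma tilted_mass_lip y y' A : 0 <= y -> y <= y' -> measurable A ->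
  A `<=` pos ->
  tilted_mass y A - tilted_mass y' A <= laplace F y - laplace F y'.
Proof.
move=> y0 yy' mA Ap; have mC : measurable (pos `\` A) by exact: measurableD.
have Cp : pos `\` A `<=` pos by move=> x [].
have lapE z : 0 <= z ->
    laplace F z = tilted_mass z A + tilted_mass z (pos `\` A).
  move=> z0; rewrite -tilted_massU ?setDUK//.
  by apply/disj_setPS => x [Ax [_]].
rewrite !lapE//; last exact: le_trans yy'.
by rewrite opprD addrACA lerDl subr_ge0; exact: tilted_mass_nincr.
Qed.

Lemma tilted_mass0 A : measurable A -> tilted_mass 0 A = fine (F A).
Proof.
move=> mA; rewrite /tilted_mass /Rintegral (eq_integral (fun=> 1%E)).
  by rewrite integral_cst// mul1e.
by move=> x _; rewrite mul0r oppr0 expR0.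
Qed.

Hypothesis F_pos : F pos = 1%E.

Lemma laplace0 : laplace F 0 = 1.
Proof.
transitivity (fine (F pos)); first exact: tilted_mass0.
exact: (congr1 fine F_pos).
Qed.

Lemma laplace_lt_anti y y' : 0 <= y -> laplace F y < laplace F y' -> y' < y.
Proof.
move=> y0; rewrite !ltNge; apply: contra => yy'.
by apply: tilted_mass_nincr.
Qed.

Lemma laplace_continuous (Y : R) :
  {within `[0, Y], continuous (laplace F)}.
Proof.
(* The maximum makes 0 an interior point of the range of the parameter. *)
pose f (l x : R) := expR (- (Num.max l 0 * x)).
have le0m (l : R) : 0 <= Num.max l 0 by rewrite le_max lexx orbT.
have fE : {in `[0, Y]%classic,
    (fun l => \int[F]_(x in pos) f l x) =1 laplace F}.
  move=> l; rewrite inE/= in_itv/= => /andP[l0 _].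
  by rewrite /f (max_idPl l0).
apply/(subspace_eq_continuous fE)/continuous_in_subspaceT => l.
rewrite inE/= in_itv/= => /andP[l0 lY].
apply: (@continuity_under_integral _ _ _ F f pos _ (- 1) (Y + 1) _ _
  (cst 1)) => //.
- by move=> z _; exact: integrable_expRNM.
- apply: aeW => x _ z _; apply: continuous_comp; last exact: continuous_expR.
  apply: continuousN; apply: continuousM; last exact: cst_continuous.
  by apply: continuous_max => //; exact: cst_continuous.
- exact: finite_measure_integrable_cst.
- move=> z _; apply: aeW => x; rewrite /= in_itv/= andbT => x0.
  by rewrite ger0_norm ?expR_ge0// expRNM_le1// ltW.
- by rewrite inE/= in_itv/=; lra.
Qed.

Lemma bigcup_measure_le (D : (set R)^nat) (c : \bar R) :
  (forall n, measurable (D n)) -> (forall n m, (n <= m)%N -> D n `<=` D m) ->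
  (forall n, (F (D n) <= c)%E) -> (F (\bigcup_n D n) <= c)%E.
Proof.
move=> mD homoD Dc.
have FD : F (D n) @[n --> \oo] --> F (\bigcup_n D n).
  apply: nondecreasing_cvg_mu => //.
    exact: (bigcup_measurable (fun n _ => mD n)).
  by move=> n m nm; rewrite subsetEset; exact: homoD.
rewrite -(cvg_lim _ FD)//; apply: lime_le; first exact: cvgP FD.
exact: nearW.
Qed.

Lemma exists_small_cdf (e : R) : 0 < e ->
  exists2 a : R, 0 < a & fine (F `]-oo, a]%classic) < e.
Proof.
move=> e0; apply: contrapT => /forall2NP small.
have : (F pos <= (1 - e)%:E)%E.
  rewrite itvoyEbigcup; apply: bigcup_measure_le => //.
    move=> n m nm x /=; rewrite !in_itv/= !andbT add0r => /(le_trans _); apply.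
    by rewrite add0r lef_pV2 ?posrE// ler_nat.
  (* The point 1/(n+2) lies strictly below 1/(n+1), so the closed half-line ending there avoids the
     n-th set of the union. *)
  move=> n; have [|/negP] := small (n.+2%:R^-1); first by rewrite invr_gt0.
  rewrite -leNgt => le_e.
  have -> : `[0 + n.+1%:R^-1, +oo[%classic =
     ~` `]-oo, (0 + n.+1%:R^-1 : R)[%classic by rewrite setCitvl.
  rewrite probability_setC// -(fineK (fin_num_measure F _ _))//.
  rewrite -EFinB lee_fin lerD2l lerN2 (le_trans le_e)//.
  rewrite fine_le ?fin_num_measure// le_measure ?inE// => x /=.
  rewrite !in_itv/= add0r => /le_lt_trans; apply.
  by rewrite ltf_pV2 ?posrE// ltr_nat.
by rewrite [leLHS]F_pos lee_fin; lra.
Qed.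

Lemma exists_large_cdf (e : R) : 0 < e ->
  exists2 K : R, 0 < K & 1 - e < fine (F `]0, K]%classic).
Proof.
move=> e0; apply: contrapT => /forall2NP large.
have : (F pos <= (1 - e)%:E)%E.
  have -> : pos = \bigcup_n `]0 : R, n.+1%:R]%classic.
    apply/seteqP; split => x /=; rewrite in_itv/= ?andbT.
      move=> x0; exists (Num.truncn x) => //=.
      by rewrite in_itv/= x0 ltW// truncnS_gt.
    by move=> [n _]; rewrite /= !in_itv/= => /andP[].
  apply: bigcup_measure_le => //.
    move=> n m nm x /=; rewrite !in_itv/= => /andP[-> /le_trans]; apply.
    by rewrite ler_nat.
  move=> n; have [|/negP] := large (n.+1%:R); first by rewrite ltr0n.
  by rewrite -leNgt -lee_fin fineK// fin_num_measure.
by rewrite [leLHS]F_pos lee_fin; lra.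
Qed.

Lemma tilted_mass_le_cst y A c : 0 <= y -> measurable A -> A `<=` pos ->
  (forall x, A x -> expR (- (y * x)) <= c) ->
  tilted_mass y A <= c * fine (F A).
Proof.
move=> y0 mA Ap ec; rewrite -(@Rintegral_cst _ _ _ F A mA c).
apply: le_Rintegral => //; first exact: integrable_expRNM.
exact: finite_measure_integrable_cst.
Qed.

Lemma exists_small_laplace (e : R) : 0 < e ->
  exists2 y : R, 0 <= y & laplace F y <= e.
Proof.
move=> e0; have [a a0 Fa] := exists_small_cdf (divr_gt0 e0 (ltr0Sn R 1)).
have e2 : 0 < e / 2 by rewrite divr_gt0.
(* Beyond [a] this gives y x >= 2 / e, and exp (- 2 / e) <= e / 2; the part up to [a] has [F]-mass
   below e / 2. *)
pose y := 2 / (e * a).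
have y0 : 0 <= y by rewrite divr_ge0 ?mulr_ge0// ltW.
exists y => //.
have posE : pos = `]0, a] `|` `]a, +oo[%classic.
  apply: (@itv_bndbnd_setU _ _ (BRight 0) (BRight a) +oo%O) => //.
  by rewrite bnd_simp ltW.
have pos2 : `]a, +oo[%classic `<=` pos by rewrite posE; exact: subsetUr.
have pos1 : `]0, a]%classic `<=` pos by rewrite posE; exact: subsetUl.
rewrite /laplace posE -/(tilted_mass y _) tilted_massU//; last first.
  apply/disj_setPS => x [] /=; rewrite !in_itv/= andbT => /andP[_ xa].
  by rewrite ltNge xa.
rewrite [leRHS]splitr lerD//.
  apply: le_trans (ltW Fa).
  apply: (@le_trans _ _ (1 * fine (F `]0, a]%classic))).
    apply: tilted_mass_le_cst => // x /=; rewrite in_itv/= => /andP[x0 _].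
    by rewrite expRNM_le1// ltW.
  rewrite mul1r fine_le ?fin_num_measure// le_measure ?inE// => x /=.
  by rewrite !in_itv/= => /andP[].
apply: (@le_trans _ _ (e / 2 * fine (F `]a, +oo[%classic))).
  apply: tilted_mass_le_cst => // x /=; rewrite in_itv/= andbT => ax.
  have ya : 2 / e <= y * x.
    rewrite (_ : 2 / e = y * a); first by rewrite ler_wpM2l// ltW.
    by rewrite /y; field; rewrite !gt_eqF.
  rewrite expRN -[leRHS]invrK lef_pV2 ?posrE ?invr_gt0 ?expR_gt0// invf_div.
  by rewrite (le_trans ya)// (le_trans _ (expR_ge1Dx _))// lerDr.
rewrite ler_piMr ?(ltW e2)// -[leRHS]/(fine 1%E) fine_le ?fin_num_measure//.
exact: probability_le1.
Qed.

(** The intermediate value theorem, between 0 where the transform is 1 and a point where it is at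
    most [u], puts [u] in the image of the half-line; the pseudo-inverse then returns a true
    preimage and not its default value. *)
Lemma laplace_invP u : 0 < u -> u <= 1 ->
  0 <= laplace_inv F u /\ laplace F (laplace_inv F u) = u.
Proof.
move=> u0 u1; have [Y Y0 Yu] := exists_small_laplace u0.
have [] := IVT (v := u) Y0 (@laplace_continuous Y).
  by rewrite laplace0 ge_min Yu orbT le_max u1.
move=> c; rewrite in_itv/= => /andP[c0 _] cu.
have im : u \in [set laplace F x | x in `[0, +oo[].
  by rewrite inE; exists c => //=; rewrite in_itv/= c0.
split; last exact: pinvK.
have surj : set_surj `[0, +oo[ [set u] (laplace F).
  by move=> _ ->; exact/set_mem.
have : `[0 : R, +oo[%classic (laplace_inv F u).
  by apply: (surjpinv_image_sub surj); exists u.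
by rewrite /= in_itv/= andbT.
Qed.

End TiltedMass.

(** * Empirical means *)

Section EmpiricalMeans.
Context {R : realType} (F : probability (measurableTypeR R) R).
Hypothesis F_pos : F `]0 : R, +oo[%classic = 1%E.
Context {n : nat} (x : 'I_n -> R).
Implicit Types (D : set R) (f : R -> R).

Definition down_closed D := forall a b, a <= b -> D b -> D a.

Definition empirical_mean f : R := (\sum_i f (x i)) / n%:R.

Lemma down_closed_measurable D : down_closed D -> measurable D.
Proof.
move=> dD; apply: is_interval_measurable => a b _ Db c /andP[_ cb].
exact: dD Db.
Qed.

Lemma down_closed_itv D : down_closed D -> D = set0 \/
  exists b : itv_bound R, D = [set` Interval -oo%O b].
Proof.
move=> dD; have : is_interval D.
  by move=> a b _ Db c /andP[_ cb]; exact: dD Db.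
move=> /is_intervalP; case: (Rhull D) => -[c s|[]] b DE.
- left; rewrite -subset0 => y Dy.
  have : D (Num.min y (s - 1)) by apply: dD Dy; rewrite ge_min lexx.
  rewrite DE /= itv_boundlr => /andP[+ _].
  have : Num.min y (s - 1) < s by rewrite gt_min ltrBlDr ltrDl ltr01 orbT.
  by case: c {DE} => /=; rewrite bnd_simp; lra.
- by right; exists b.
- by left; rewrite DE; apply/seteqP; split => y //=; rewrite itv_boundlr.
Qed.

(** A nonempty initial segment is either a closed half-line or an increasing union of closed
    half-lines, so continuity from below applies. *)
Lemma down_closed_measure_le D (c : R) : down_closed D -> 0 <= c ->
  (forall a, D a -> fine (F `]-oo, a]%classic) <= c) -> fine (F D) <= c.
Proof.
move=> /down_closed_itv[-> c0 _|[b ->] c0 Dc]; first by rewrite measure0.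
have {}Dc a : [set` Interval -oo%O b] a -> (F `]-oo, a]%classic <= c%:E)%E.
  by move=> /Dc; rewrite -lee_fin fineK ?fin_num_measure.
rewrite -lee_fin fineK ?fin_num_measure//.
have homo_le (g : nat -> R) : (forall p q, (p <= q)%N -> g p <= g q) ->
    forall p q, (p <= q)%N -> `]-oo, g p]%classic `<=` `]-oo, g q]%classic.
  by move=> gh p q pq y /=; rewrite !in_itv/= => /le_trans; apply; exact: gh.
case: b Dc => [[] s|[]] Dc.
- have -> : `]-oo, s[%classic = \bigcup_k `]-oo, s - k.+1%:R^-1]%classic.
    apply/seteqP; split => y /=; rewrite in_itv/=.
      move=> ys; exists (Num.truncn ((s - y)^-1)) => //=.
      rewrite in_itv/= lerBrDr -lerBrDl.
      rewrite -[leRHS]invrK lef_pV2 ?posrE ?invr_gt0 ?subr_gt0//.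
      by rewrite ltW// truncnS_gt.
    move=> [k _]; rewrite /= in_itv/= => /le_lt_trans; apply.
    by rewrite ltrBlDr ltrDl.
  apply: bigcup_measure_le => //.
    apply: homo_le => p q pq.
    by rewrite lerD2l lerN2 lef_pV2 ?posrE// ler_nat.
  by move=> k; apply: Dc; rewrite /= in_itv/= ltrBlDr ltrDl.
- by apply: Dc; rewrite /= in_itv/=.
- by rewrite (_ : [set` _] = set0) ?measure0//; apply/seteqP; split.
- have -> : `]-oo, +oo[%classic = \bigcup_k `]-oo, k%:R : R]%classic.
    apply/seteqP; split => y //= _; exists (Num.truncn y).+1 => //=.
    by rewrite in_itv/= ltW// truncnS_gt.
  apply: bigcup_measure_le => //.
    by apply: homo_le => p q pq; rewrite ler_nat.
  by move=> k; exact: Dc.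
Qed.

Variable e : R.
Hypothesis n_gt0 : (0 < n)%N.
Hypothesis cdf_close : forall a,
  `|empirical_cdf x a - fine (F `]-oo, a]%classic)| <= e.

Lemma empirical_cdfE a :
  empirical_cdf x a = empirical_mean (\1_(`]-oo, a]%classic)).
Proof.
rewrite /empirical_cdf /empirical_mean; congr (_ / _).
rewrite -sum1_card natr_sum big_mkcond/=; apply: eq_bigr => i _.
by rewrite indicE inE mem_setE in_itv/=; case: (_ <= _).
Qed.

(** In one direction, [F D] is approached by closed half-lines inside [D]. In the other, the sample
    meets [D] exactly in the closed half-line ending at the largest sample point of [D], if there is
    one. *)
Lemma empirical_mean_down D : down_closed D ->
  `|empirical_mean \1_D - fine (F D)| <= e.
Proof.
move=> dD; have mD := down_closed_measurable dD.
have n0 : (0 : R) < n%:R by rewrite ltr0n.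
have e0 : 0 <= e by exact: le_trans (cdf_close 0).
have mono (D1 D2 : set R) : (forall i, D1 (x i) -> D2 (x i)) ->
    empirical_mean \1_D1 <= empirical_mean \1_D2.
  move=> D12; rewrite ler_pM2r ?invr_gt0//; apply: ler_sum => i _.
  rewrite !indicE ler_nat; case: (boolP (x i \in D1)) => //.
  by rewrite inE => /D12/mem_set ->.
rewrite ler_norml; apply/andP; split.
  have mean_ge0 : 0 <= empirical_mean \1_D.
    by rewrite divr_ge0// sumr_ge0// => i _; rewrite indicE.
  suff : fine (F D) <= empirical_mean \1_D + e by lra.
  apply: down_closed_measure_le => //; first exact: addr_ge0.
  move=> a Da; have := cdf_close a; rewrite ler_norml => /andP[+ _].
  rewrite empirical_cdfE => ?.
  have : empirical_mean \1_(`]-oo, a]%classic) <= empirical_mean \1_D.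
    by apply: mono => i /=; rewrite in_itv/= => /dD; apply.
  by lra.
have [[i0 Di0]|noD] := pselect (exists i, D (x i)); last first.
  rewrite {1}/empirical_mean big1 ?mul0r ?sub0r.
    by rewrite (le_trans _ e0)// oppr_le0 fine_ge0.
  move=> i _; rewrite indicE; apply/eqP; rewrite pnatr_eq0 eqb0.
  by apply/negP; rewrite inE => Di; apply: noD; exists i.
case: (@Order.TotalTheory.arg_maxP _ _ _ i0 (fun i => x i \in D) x
  (mem_set Di0)).
move=> j /set_mem Dj jmax.
have := cdf_close (x j); rewrite ler_norml empirical_cdfE => /andP[_].
have : empirical_mean \1_D <= empirical_mean \1_(`]-oo, x j]%classic).
  by apply: mono => i /mem_set/jmax; rewrite /= in_itv.
have : fine (F `]-oo, x j]%classic) <= fine (F D).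
  rewrite fine_le ?fin_num_measure// le_measure ?inE// => y /=.
  by rewrite in_itv/= => /dD; apply.
lra.
Qed.

(** The sum counts the integers from 1 to [M] that are at most [v]: it is the floor of [v]. *)
Lemma layer_count (M : nat) (v : R) : 0 <= v -> v <= M%:R ->
  \sum_(j < M) (j.+1%:R <= v)%R%:R <= v <=
  \sum_(j < M) (j.+1%:R <= v)%R%:R + 1.
Proof.
move=> v0 vM.
have -> : \sum_(j < M) (j.+1%:R <= v)%R%:R = (Num.truncn v)%:R :> R.
  have kM : (Num.truncn v <= M)%N.
    by rewrite -(ler_nat R) (le_trans _ vM)// truncn_le.
  rewrite -natr_sum; congr (_%:R).
  under eq_bigr do rewrite -truncn_gt_nat.
  elim: M (Num.truncn v) kM {vM} => [k|M IH k kM].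
    by rewrite leqn0 => /eqP ->; rewrite big_ord0.
  move: kM; rewrite big_ord_recr/= leq_eqVlt => /predU1P[->|].
    rewrite ltnSn (eq_bigr (fun=> 1%N)) ?sum1_card ?card_ord ?addn1//.
    by move=> j _; rewrite ltnW ?ltnS ?ltn_ord// ltnW.
  by rewrite ltnS => kM; rewrite IH// ltnNge kM addn0.
by have /andP[-> /ltW] := truncn_itv v0; rewrite natr1.
Qed.

Lemma integrable_bounded_prob (g : R -> R) (c : R) : measurable_fun setT g ->
  (forall z, 0 <= g z <= c) -> F.-integrable setT (EFin \o g).
Proof.
move=> mg gc; apply: (@le_integrable _ _ _ F setT _ _ (EFin \o cst c)) => //.
- exact/measurable_EFinP.
- move=> z _; have /andP[g0 ?] := gc z.
  by rewrite lee_fin !ger0_norm// (le_trans g0).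
- exact: finite_measure_integrable_cst.
Qed.

(* A function with values in [0, 1] is, up to 1/M, the average of the indicators
   of its M superlevel sets, which are initial segments here. *)
Lemma empirical_mean_nincr f : measurable_fun setT f ->
  (forall z, 0 <= f z <= 1) ->
  (forall t, 0 < t -> down_closed [set z | t <= f z]) ->
  `|empirical_mean f - \int[F]_(z in setT) f z| <= e.
Proof.
move=> mf f01 df; have n0 : (0 : R) < n%:R by rewrite ltr0n.
(* The 1 is the error of replacing [M%:R * f] by its floor [N]; it becomes negligible against [M] as
   [M] grows. *)
suff close (M : nat) : (0 < M)%N ->
    M%:R * `|empirical_mean f - \int[F]_(z in setT) f z| <= M%:R * e + 1.
  rewrite leNgt; apply/negP; set E := `|_| => eE.
  pose M := (Num.truncn ((E - e)^-1)).+1.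
  have := close M isT; rewrite -/E.
  have : (E - e)^-1 < M%:R by exact: truncnS_gt.
  have Ee : 0 < E - e by rewrite subr_gt0.
  rewrite -(ltr_pM2r Ee) mulVf ?gt_eqF// mulrBr; lra.
move=> M0; have M0r : (0 : R) < M%:R by rewrite ltr0n.
pose D (j : 'I_M) := [set z | j.+1%:R <= M%:R * f z].
have dD j : down_closed (D j).
  have -> : D j = [set z | j.+1%:R / M%:R <= f z].
    by apply/seteqP; split => z /=; rewrite ler_pdivrMr// mulrC.
  by apply: df; rewrite divr_gt0.
have mD j := down_closed_measurable (dD j).
pose N z : R := \sum_(j < M) \1_(D j) z.
have mN : measurable_fun setT N.
  by apply: measurable_sum => j; exact: measurable_indic.
have N_bnd z : N z <= M%:R * f z <= N z + 1.
  have /andP[f0 f1] := f01 z.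
  have -> : N z = \sum_(j < M) (j.+1%:R <= M%:R * f z)%R%:R.
    by apply: eq_bigr => j _; rewrite indicE mem_setE.
  apply: layer_count; first by rewrite mulr_ge0.
  by rewrite ler_piMr.
have intf := integrable_bounded_prob mf f01.
have intMf : F.-integrable setT (EFin \o (fun z => M%:R * f z)).
  apply: (@integrable_bounded_prob _ M%:R); first exact: measurable_funM.
  by move=> z; have /andP[f0 f1] := f01 z; rewrite mulr_ge0// ler_piMr.
have N0 z : 0 <= N z by apply: sumr_ge0 => j _; rewrite indicE.
have intN : F.-integrable setT (EFin \o N).
  apply: (@integrable_bounded_prob _ M%:R) => // z.
  have /andP[f0 f1] := f01 z; have /andP[Nf _] := N_bnd z.
  by rewrite N0 (le_trans Nf)// ler_piMr.
have int1 : F.-integrable setT (EFin \o cst (1 : R)).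
  exact: finite_measure_integrable_cst.
have intN1 : F.-integrable setT (EFin \o (fun z => N z + 1)).
  apply: (@integrable_bounded_prob _ (M%:R + 1)); first exact: measurable_funD.
  move=> z; have /andP[f0 f1] := f01 z; have /andP[Nf _] := N_bnd z.
  by rewrite addr_ge0// lerD2r (le_trans Nf)// ler_piMr.
have int_N : \int[F]_(z in setT) N z = \sum_(j < M) fine (F (D j)).
  rewrite /Rintegral sum_fine; last first.
    by move=> j _; apply: fin_num_measure; exact: mD.
  congr fine; under eq_integral do rewrite /N -sumEFin.
  rewrite ge0_integral_sum//.
  - apply: eq_bigr => j _; rewrite integral_indic//; first by rewrite setIT.
    exact: mD.
  - by move=> j; apply/measurable_EFinP; apply: measurable_indic; exact: mD.
have mean_N : empirical_mean N = \sum_(j < M) empirical_mean \1_(D j).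
  by rewrite /empirical_mean -mulr_suml exchange_big.
have mean_Mf : M%:R * empirical_mean f = empirical_mean (fun z => M%:R * f z).
  by rewrite /empirical_mean mulrA mulr_sumr.
have mean_N1 : empirical_mean N + 1 = empirical_mean (fun z => N z + 1).
  rewrite /empirical_mean big_split/= mulrDl; congr (_ + _).
  by rewrite sumr_const card_ord divff ?gt_eqF.
have mean_mono g h : (forall z, g z <= h z) ->
    empirical_mean g <= empirical_mean h.
  by move=> gh; rewrite ler_pM2r ?invr_gt0//; apply: ler_sum.
have close_N : `|empirical_mean N - \int[F]_(z in setT) N z| <= M%:R * e.
  rewrite mean_N int_N -sumrB (le_trans (ler_norm_sum _ _ _))//.
  rewrite mulr_natl -[leRHS](_ : \sum_(j < M) e = _); last first.
    by rewrite sumr_const card_ord.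
  by apply: ler_sum => j _; exact: empirical_mean_down.
have mean_lo : empirical_mean N <= M%:R * empirical_mean f.
  by rewrite mean_Mf; apply: mean_mono => z; have /andP[] := N_bnd z.
have mean_hi : M%:R * empirical_mean f <= empirical_mean N + 1.
  by rewrite mean_Mf mean_N1; apply: mean_mono => z; have /andP[] := N_bnd z.
have int_lo : \int[F]_(z in setT) N z <= M%:R * \int[F]_(z in setT) f z.
  rewrite -RintegralZl//; apply: le_Rintegral => // z _.
  by have /andP[] := N_bnd z.
have int_hi : M%:R * \int[F]_(z in setT) f z <= \int[F]_(z in setT) N z + 1.
  rewrite -RintegralZl//.
  have -> : \int[F]_(z in setT) N z + 1 = \int[F]_(z in setT) (N z + 1).
    rewrite RintegralD//= Rintegral_cst// mul1r.
    by congr (_ + _); exact: esym (congr1 fine (probability_setT F)).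
  by apply: le_Rintegral => // z _; have /andP[] := N_bnd z.
rewrite -[M%:R in leLHS]gtr0_norm// -normrM mulrBr.
move: close_N mean_lo mean_hi int_lo int_hi.
move: (empirical_mean N) (M%:R * empirical_mean f) (\int[F]_(z in setT) N z)
  (M%:R * \int[F]_(z in setT) f z) => p q r s.
by rewrite !ler_norml => /andP[? ?] *; apply/andP; split; lra.
Qed.

Lemma empirical_tilted_down y D : 0 <= y -> (forall i, 0 < x i) ->
  down_closed D ->
  `|empirical_mean (fun z => \1_D z * expR (- (y * z))) -
    tilted_mass F y (D `&` `]0, +oo[)| <= e.
Proof.
move=> y0 x_gt0 dD; have mD := down_closed_measurable dD.
(* Truncating at 0 keeps the function in [0, 1] on the whole line, and changes it neither at the
   sample points nor on the half-line that carries [F]. *)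
pose f (z : R) : R := \1_D z * expR (- (y * Num.max z 0)).
have m0 (z : R) : 0 <= Num.max z 0 by rewrite le_max lexx orbT.
have f01 z : 0 <= f z <= 1.
  rewrite /f indicE mulr_ge0 ?expR_ge0//=.
  by case: (z \in D); rewrite ?mul0r// mul1r expRNM_le1.
have mf : measurable_fun setT f.
  apply: measurable_funM; first exact: measurable_indic.
  apply: (measurableT_comp (@measurable_expRNM R y setT)).
  exact: measurable_maxr.
have mP : measurable (`]0 : R, +oo[%classic : set R) by [].
have -> : empirical_mean (fun z => \1_D z * expR (- (y * z))) =
    empirical_mean f.
  congr (_ / _); apply: eq_bigr => i _.
  by rewrite /f (max_idPl (ltW (x_gt0 i))).
have posC : ~` `]0 : R, +oo[%classic = `]-oo, 0 : R]%classic.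
  by rewrite setCitvr.
have F_neg : F `]-oo, 0 : R]%classic = 0%E.
  rewrite -posC probability_setC//.
  by transitivity (1 - 1 : \bar R)%E; [congr (1 - _)%E|rewrite subee].
have -> : tilted_mass F y (D `&` `]0, +oo[) = \int[F]_(z in setT) f z.
  have intf := integrable_bounded_prob mf f01.
  have TE : [set: R] = `]-oo, 0 : R]%classic `|` `]0 : R, +oo[%classic.
    by rewrite -posC setUC setUv.
  rewrite TE Rintegral_setU//; last 2 first.
  - by rewrite -TE.
  - apply/disj_setPS => z [] /=; rewrite !in_itv/= andbT => z0.
    by rewrite ltNge z0.
  rewrite [X in X + _](_ : _ = 0) ?add0r; last first.
    rewrite /Rintegral null_set_integral//.
    by apply/measurable_EFinP; exact: measurable_funTS.
  rewrite /tilted_mass /Rintegral setIC integral_mkcondr; congr fine.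
  apply: eq_integral => z; rewrite inE/= in_itv/= andbT => z0.
  rewrite patchE /f indicE (max_idPl (ltW z0)).
  by case: (z \in D); rewrite ?mul1r ?mul0r.
apply: empirical_mean_nincr => // t t0 a b ab /= tb.
have Db : D b.
  apply: contrapT => nDb; move: tb; rewrite /f indicE memNset// mul0r.
  by rewrite leNgt t0.
have Da := dD _ _ ab Db.
rewrite (le_trans tb)// /f !indicE !mem_set// !mul1r ler_expR lerN2.
by rewrite ler_wpM2l// le_max2.
Qed.

End EmpiricalMeans.

(** * Exponential tail bounds *)

Section Remaining.
Context {R : realType} {n : nat} (x : 'I_n -> R).
Implicit Types (s : 'S_n) (k : nat) (A : pred 'I_n).

Lemma kept_ge0 A s k : 0 <= kept A s k :> R.
Proof. by apply: sumr_ge0. Qed.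

Lemma kept_predT s k : kept predT s k = (n - k)%:R :> R.
Proof. by rewrite /kept sumr_const card_ge_ord. Qed.

Lemma kept_predC A s k : kept A s k + kept (predC A) s k = (n - k)%:R :> R.
Proof.
rewrite -(kept_predT s) -big_split/=; apply: eq_bigr => l _.
by rewrite /=; case: (A (s l)); rewrite ?addr0 ?add0r.
Qed.

Lemma kept_le A s k : kept A s k <= (n - k)%:R :> R.
Proof. by rewrite -(kept_predC A s) lerDl kept_ge0. Qed.

Lemma kept_anti A s k k' : (k <= k')%N -> kept A s k' <= kept A s k :> R.
Proof.
move=> kk'; rewrite /kept big_mkcond [leRHS]big_mkcond; apply: ler_sum => l _.
case: leqP => // k'l; first by rewrite (leq_trans kk').
by case: ifP.
Qed.

Lemma kept0 A s : kept A s 0 = \sum_i (A i)%:R :> R.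
Proof. by rewrite [RHS](reindex_inj (@perm_inj _ s)). Qed.

Lemma kept_ge A s k : (k <= n)%N -> \sum_i (A i)%:R - k%:R <= kept A s k :> R.
Proof.
move=> kn; have := kept_predC A s k; have := kept_predC A s 0.
have := kept_anti (predC A) s (leq0n k).
by rewrite !kept0 subn0 natrB//; lra.
Qed.

Lemma perm_prob_union (T : finType) (B B0 : pred 'S_n) (E : T -> pred 'S_n) :
  (forall i, 0 < x i) ->
  (forall s, B s -> B0 s \/ exists t, E t s) ->
  perm_prob x B <= perm_prob x B0 + \sum_t perm_prob x (E t).
Proof.
move=> x_gt0 BE; rewrite /perm_prob.
under [X in _ + X]eq_bigr do rewrite big_mkcond.
rewrite exchange_big/= big_mkcond [X in X + _]big_mkcond -big_split/=.
apply: ler_sum => s _.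
have pp0 := prefix_prob_ge0 x_gt0 s n.
have sum0 (Q : pred T) :
    0 <= \sum_(t | Q t) (if E t s then prefix_prob x s n else 0).
  by apply: sumr_ge0 => t _; case: ifP.
case: ifP => Bs; last by rewrite addr_ge0 ?sum0//; case: ifP.
have [->|[t Et]] := BE _ Bs; first by rewrite lerDl sum0.
rewrite (bigD1 t)//= Et addrCA lerDl addr_ge0 ?sum0//.
by case: ifP.
Qed.

Hypothesis x_gt0 : forall i, 0 < x i.

(** Of the n - k survivors, no more are light than there are light items in the whole sample; each
    of the others weighs more than [a]. *)
Lemma rest_weight_ge (a : R) s k : 0 <= a ->
  a * ((n - k)%:R - \sum_i (x i <= a)%R%:R) <= rest_weight x s k.
Proof.
move=> a0; apply: (@le_trans _ _ (a * kept (fun i => ~~ (x i <= a)) s k)).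
  rewrite ler_wpM2l//.
  have := kept_predC (fun i => x i <= a) s k.
  have := kept_anti (fun i => x i <= a) s (leq0n k).
  by rewrite kept0 /predC; lra.
rewrite /kept mulr_sumr; apply: ler_sum => l _.
by case: (leP (x (s l)) a) => /= [_|/ltW]; rewrite ?mulr0 ?mulr1// ltW.
Qed.

(* The traces of the initial segments on the sample ([t.2 = false]), the empty
   one being [t.1 = None], and their complements ([t.2 = true]). *)
Definition trace (t : option 'I_n * bool) : pred 'I_n := fun i =>
  t.2 (+) (if t.1 is Some j then x i <= x j else false).

Lemma down_closed_trace D : down_closed D ->
  exists o, forall i, (x i \in D) = trace (o, false) i.
Proof.
move=> dD; have [[i0 Di0]|noD] := pselect (exists i, D (x i)); last first.
  by exists None => i; apply/negP; rewrite inE => Di; apply: noD; exists i.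
case: (@Order.TotalTheory.arg_maxP _ _ _ i0 (fun i => x i \in D) x
  (mem_set Di0)).
move=> j /set_mem Dj jmax; exists (Some j) => i; rewrite /trace/=.
by apply/idP/idP => [/jmax//|ij]; rewrite inE; exact: dD Dj.
Qed.

Lemma upper_tail_bound A (y e : R) k :
  (k <= n)%N -> 0 <= y -> 0 < e -> e <= 1 ->
  perm_prob x [pred s | (y <= clock x s k) &&
    (\sum_(i | A i) expR (- (x i * y)) + n%:R * e <= kept A s k)] <=
  expR (- (e ^+ 2 / 8 * n%:R)).
Proof.
move=> kn y0 e0 e1; set S := \sum_(i | A i) _.
(* With at most n expected survivors the exponent is at most n (2 t^2 - t e), minimal at t = e / 4
   where it equals - n e^2 / 8. *)
have t0 : 0 <= e / 4 by lra.
apply: le_trans (@upper_tail _ _ x x_gt0 A y (e / 4) _ k kn t0) _.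
rewrite ler_expR -/S.
have S0 : 0 <= S by apply: sumr_ge0 => i _; exact: expR_ge0.
have Sn : S <= n%:R.
  have -> : n%:R = \sum_(i < n) 1 :> R by rewrite sumr_const card_ord.
  rewrite /S big_mkcond/=; apply: ler_sum => i _; case: ifP => // _.
  by rewrite mulrC expRNM_le1// ltW.
have : expR (e / 4) <= 1 + e / 4 + 2 * (e / 4) ^+ 2.
  by apply: expR_le_quad => //; lra.
rewrite -lerBlDl => Et.
have : (expR (e / 4) - 1 - e / 4) * S <= 2 * (e / 4) ^+ 2 * n%:R.
  apply: (@le_trans _ _ (2 * (e / 4) ^+ 2 * S)).
    by rewrite ler_wpM2r//; lra.
  by rewrite ler_wpM2l// mulr_ge0 ?sqr_ge0.
by nra.
Qed.

(** At most n v items are left after [k] removals, whereas at least n (v + g) items of size at most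
    [K] would be expected at time [y], even with rates multiplied by [u]. A late clock is thus a
    lower deviation of at least n g. The bounds on [a] and [K] make single removal probabilities
    small. *)
Lemma lower_tail_bound (y u K a v g : R) k :
  (k <= n)%N -> 0 <= y -> 1 <= u -> 0 < a -> 0 <= K -> 0 < v -> v <= 1 ->
  0 < g -> g <= 1 ->
  (n - k)%:R <= n%:R * v -> n%:R * v <= (n - k).+1%:R ->
  \sum_i (x i <= a)%R%:R <= n%:R * v / 2 ->
  K * (2 + u ^+ 2) <= (u - 1) * (a * (n%:R * v / 2)) ->
  n%:R * (v + g) <= \sum_(i | x i <= K) expR (- (u * x i * y)) ->
  perm_prob x [pred s | clock x s k <= y] <= expR (- (g ^+ 2 / 8 * n%:R)).
Proof.
move=> kn y0 u1 a0 K0 v0 v1 g0 g1 knv nvk small_a large_n S_ge.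
have c0 : 0 <= g / 4 by lra.
have c1 : g / 4 <= 2^-1 by lra.
set A : pred 'I_n := fun i => x i <= K.
have small (b : 'I_n) s i : (b < k)%N -> A i ->
    x i / rest_weight x s b * (2 + u ^+ 2) <= u - 1.
  move=> bk xK; have T0 := rest_weight_gt0 x_gt0 s b.
  rewrite mulrAC ler_pdivrMr//.
  have : x i * (2 + u ^+ 2) <= K * (2 + u ^+ 2).
    by rewrite ler_wpM2r// addr_ge0// sqr_ge0.
  move=> /le_trans; apply; apply: le_trans large_n _.
  rewrite ler_wpM2l ?subr_ge0// (le_trans _ (rest_weight_ge s b (ltW a0)))//.
  rewrite ler_wpM2l ?(ltW a0)//.
  (* Before the k-th removal at least n - k + 1 >= n v items are present, of which at most n v / 2
     are light. *)
  have : ((n - k).+1)%:R <= (n - b)%:R :> R by rewrite ler_nat ltn_sub2l.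
  by lra.
have -> : perm_prob x [pred s | clock x s k <= y] =
    perm_prob x [pred s | (clock x s k <= y) && (kept A s k <= n%:R * v)].
  by apply: eq_bigl => s /=; rewrite (le_trans (kept_le A s k)) ?andbT.
apply: le_trans (lower_tail x_gt0 _ kn y0 u1 c0 c1 small) _.
rewrite ler_expR.
set S := \sum_(i | _) _; rewrite -/S in S_ge.
have : g / 4 * (n%:R * (v + g)) <= g / 4 * S by rewrite ler_wpM2l.
have vn : 0 <= (1 - v) * n%:R.
  by rewrite mulr_ge0// subr_ge0.
have : 2 * (g / 4) ^+ 2 * ((1 - v) * n%:R) >= 0.
  by rewrite mulr_ge0// mulr_ge0// sqr_ge0.
by nra.
Qed.

End Remaining.

(** * Survivor counts against tilted masses, for one permutation *)

Section TiltedSurvivors.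
Context {R : realType} (F : probability (measurableTypeR R) R).
Hypothesis F_pos : F `]0 : R, +oo[%classic = 1%E.
Local Notation pos := `]0 : R, +oo[%classic.

(* [tilted_rest u D] is [u * F_u(D)]. *)
Definition tilted_rest (u : R) (D : set R) : R :=
  tilted_mass F (laplace_inv F u) (D `&` pos).

Lemma tilted_rest_lip (u v : R) (D : set R) : measurable D ->
  0 < u -> u <= v -> v <= 1 ->
  tilted_rest u D <= tilted_rest v D <= tilted_rest u D + (v - u).
Proof.
move=> mD u0 uv v1.
have mDp : measurable (D `&` pos) by exact: measurableI.
have Dp : D `&` pos `<=` pos by exact: subIsetr.
have [yu0 yuE] := laplace_invP F_pos u0 (le_trans uv v1).
have [yv0 yvE] := laplace_invP F_pos (lt_le_trans u0 uv) v1.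
have yvu : laplace_inv F v <= laplace_inv F u.
  move: uv; rewrite le_eqVlt => /predU1P[->//|uv].
  by apply/ltW; apply: (@laplace_lt_anti _ F _ _ yu0); rewrite yuE yvE.
have := tilted_mass_nincr F yv0 yvu mDp Dp.
have := tilted_mass_lip F yv0 yvu mDp Dp.
rewrite yuE yvE -/(tilted_rest u D) -/(tilted_rest v D).
by move: (tilted_rest _ _) (tilted_rest _ _) => a b; lra.
Qed.

Section FixedSize.
Context {n : nat} (x : 'I_n -> R).
Hypotheses (n_gt0 : (0 < n)%N) (x_gt0 : forall i, 0 < x i).
Variable h : R.
Hypothesis cdf_close : forall a,
  `|empirical_cdf x a - fine (F `]-oo, a]%classic)| <= h.

Lemma down_sum_close (y : R) (D : set R) : 0 <= y -> down_closed D ->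
  `|\sum_(i | x i \in D) expR (- (x i * y)) -
    n%:R * tilted_mass F y (D `&` pos)| <= n%:R * h.
Proof.
move=> y0 dD; have n0 : (0 : R) < n%:R by rewrite ltr0n.
have := empirical_tilted_down F_pos n_gt0 cdf_close y0 x_gt0 dD.
rewrite -(ler_pM2l n0) -{1}(gtr0_norm n0) -normrM mulrBr.
rewrite /empirical_mean mulrCA divff ?gt_eqF// mulr1.
congr (`|_ - _| <= _); rewrite [RHS]big_mkcond/=; apply: eq_bigr => i _.
by rewrite indicE mulrC [y * _]mulrC; case: (_ \in _); rewrite ?mulr1 ?mulr0.
Qed.

Variables (u : R) (s : 'S_n).
Hypotheses (u_gt0 : 0 < u) (u_le1 : u <= 1).
Local Notation m := (Num.truncn (n%:R * u)).

Lemma size_bounds : [/\ (m <= n)%N, m%:R <= n%:R * u & n%:R * u <= m%:R + 1].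
Proof.
have nu0 : 0 <= n%:R * u by rewrite mulr_ge0// ltW.
have /andP[m1 m2] := truncn_itv nu0; split=> //; last by rewrite natr1 ltW.
by rewrite -(ler_nat R) (le_trans m1)// ler_piMr.
Qed.

(** The lower bound for [D] is the upper bound for its complement, the total number of survivors
    being fixed. Reading the masses at [y1] instead of [laplace_inv F u] costs at most [e], and the
    final 1 is the rounding of n u. *)
Lemma kept_close (y1 e : R) (D : set R) : 0 <= y1 -> down_closed D ->
  laplace F y1 = u + e -> 0 < e ->
  (forall t, kept (trace x t) s (n - m) <=
     \sum_(i | trace x t i) expR (- (x i * y1)) + n%:R * e) ->
  `|kept (fun i => x i \in D) s (n - m) - n%:R * tilted_rest u D| <=
  n%:R * (2 * e + 2 * h) + 1.
Proof.
move=> y10 dD y1E e0 le_kept; have [mn mu um] := size_bounds.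
have n0 : (0 : R) < n%:R by rewrite ltr0n.
have mD := down_closed_measurable dD.
have mDp : measurable (D `&` pos) by exact: measurableI.
have Dp : D `&` pos `<=` pos by exact: subIsetr.
have [y0 yE] := laplace_invP F_pos u_gt0 u_le1.
have y1y : y1 <= laplace_inv F u.
  by apply/ltW; apply: (@laplace_lt_anti _ F _ _ y0); rewrite yE y1E ltrDl.
have lo := tilted_mass_nincr F y10 y1y mDp Dp.
have := tilted_mass_lip F y10 y1y mDp Dp.
rewrite y1E yE [X in _ <= X -> _](_ : _ = e); last by ring.
rewrite -/(tilted_rest u D) in lo *; set T1 := tilted_mass F y1 _ in lo * => hi.
have nlo : n%:R * tilted_rest u D <= n%:R * T1 by rewrite ler_pM2l.
have nhi : n%:R * T1 <= n%:R * tilted_rest u D + n%:R * e.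
  by rewrite -mulrDr ler_pM2l//; lra.
have [j jE] := down_closed_trace x dD.
have keptE : kept (fun i => x i \in D) s (n - m) =
    kept (trace x (j, false)) s (n - m) :> R.
  by apply: eq_bigr => l _; rewrite jE.
have k_le := le_kept (j, false); rewrite -keptE in k_le.
have sumE : \sum_(i | trace x (j, false) i) expR (- (x i * y1)) =
    \sum_(i | x i \in D) expR (- (x i * y1)) :> R.
  by apply: eq_bigl => i; rewrite jE.
rewrite sumE in k_le.
have := down_sum_close y10 dD; rewrite -/T1 ler_norml => /andP[S1 S2].
have dT : down_closed [set: R] by [].
have := down_sum_close y10 dT.
rewrite setTI (_ : tilted_mass F y1 pos = u + e)// ler_norml => /andP[_ ST].
have cmp := le_kept (j, true).
have cmpE : kept (trace x (j, true)) s (n - m) =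
    kept (predC (fun i => x i \in D)) s (n - m) :> R.
  by apply: eq_bigr => l _; rewrite /= jE.
have := @kept_predC R n (fun i => x i \in D) s (n - m).
rewrite subKn// -cmpE => kE.
have sumC : \sum_(i | trace x (j, true) i) expR (- (x i * y1)) =
    \sum_(i | x i \in [set: R]) expR (- (x i * y1)) -
    \sum_(i | x i \in D) expR (- (x i * y1)) :> R.
  rewrite [X in _ = X - _](bigID (fun i => x i \in D))/=.
  rewrite [X in _ = X + _ - _](eq_bigl (fun i => x i \in D)); last first.
    by move=> i; rewrite in_setT.
  rewrite addrC addKr; apply: eq_bigl => i; rewrite jE in_setT.
  by [].
rewrite sumC in cmp.
move: kE cmp k_le S1 S2 ST nlo nhi um.
move: (kept _ _ _) (kept _ _ _) (\sum_(i | x i \in D) _) (\sum_(i | _) _)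
  (n%:R * tilted_rest u D) => k1 k2 S T q.
rewrite ler_norml mulrDr => *; apply/andP; split; lra.
Qed.

(** Both terms are compared with time 0: at most n e + 1 items have been removed, and the tilted
    mass has dropped by at most [e]. *)
Lemma kept_close_trivial (e : R) (D : set R) : down_closed D -> 1 - u <= e ->
  `|kept (fun i => x i \in D) s (n - m) - n%:R * tilted_rest u D| <=
  n%:R * (e + h) + 1.
Proof.
move=> dD ue; have [mn mu um] := size_bounds.
have n0 : (0 : R) < n%:R by rewrite ltr0n.
have mD := down_closed_measurable dD.
have [y0 yE] := laplace_invP F_pos u_gt0 u_le1.
have mDp : measurable (D `&` pos) by exact: measurableI.
have Dp : D `&` pos `<=` pos by exact: subIsetr.
have lo := tilted_mass_nincr F (lexx 0) y0 mDp Dp.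
have := tilted_mass_lip F (lexx 0) y0 mDp Dp.
rewrite laplace0// yE -/(tilted_rest u D) in lo * => hi.
have := down_sum_close (lexx 0) dD.
have -> : \sum_(i | x i \in D) expR (- (x i * 0)) = \sum_i (x i \in D)%:R :> R.
  rewrite big_mkcond/=; apply: eq_bigr => i _.
  by rewrite mulr0 oppr0 expR0; case: ifP.
rewrite -(kept0 _ s); set T0 := tilted_mass F 0 _ in lo hi * => S0.
have k_le := @kept_anti R n (fun i => x i \in D) s _ _ (leq0n (n - m)).
have dn := @kept_ge R n (fun i => x i \in D) s _ (leq_subr m n).
rewrite -(kept0 _ s) natrB// in dn.
have nlo : n%:R * tilted_rest u D <= n%:R * T0 by rewrite ler_pM2l.
have nhi : n%:R * T0 <= n%:R * tilted_rest u D + n%:R * e.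
  by rewrite -mulrDr ler_pM2l//; lra.
have nue : n%:R - n%:R * u <= n%:R * e.
  by rewrite -{1}[n%:R]mulr1 -mulrBr ler_pM2l.
move: S0 k_le dn nlo nhi nue um.
move: (kept _ _ _) (kept _ _ _) (n%:R * tilted_rest u D) => k1 k2 q.
rewrite !ler_norml mulrDr => /andP[? ?] *; apply/andP; split; lra.
Qed.

End FixedSize.
End TiltedSurvivors.

(** * Exponentially small failure probabilities for a fixed proportion u *)

Section Concentration.
Context {R : realType} (F : probability (measurableTypeR R) R).
Hypothesis F_pos : F `]0 : R, +oo[%classic = 1%E.
Local Notation pos := `]0 : R, +oo[%classic.
Variable x : forall n : nat, 'I_n -> R.
Hypothesis x_gt0 : forall (n : nat) (i : 'I_n), 0 < x i.
Hypothesis x_cvg :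
  ereal_sup [set `|(empirical_cdf (@x n) a)%:E - F `]-oo, a]%classic|%E
               | a in [set: R]] @[n --> \oo] --> 0%E.

Lemma cdf_eventually_close (h : R) : 0 < h -> \forall n \near \oo, forall a,
  `|empirical_cdf (@x n) a - fine (F `]-oo, a]%classic)| <= h.
Proof.
move=> h0; have /fine_cvgP[fin_sup sup_cvg] := x_cvg.
have /cvgr0Pnorm_lt/(_ _ h0) := sup_cvg.
apply: filterS2 fin_sup => n fin_n sup_h a.
rewrite -lee_fin; apply: (@le_trans _ _ (ereal_sup
  [set `|(empirical_cdf (@x n) a)%:E - F `]-oo, a]%classic|%E
    | a in [set: R]])).
  apply: ereal_sup_ubound; exists a => //.
  by rewrite -[in LHS](fineK (fin_num_measure F _ _)).
by rewrite -(fineK fin_n) lee_fin (le_trans (ler_norm _))// ltW.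
Qed.

Definition rest_close (e u : R) (n : nat) (s : 'S_n) : Prop :=
  forall D, down_closed D ->
  `|kept (fun i => x i \in D) s (n - Num.truncn (n%:R * u)) -
    n%:R * tilted_rest F u D| <= n%:R * e.

Lemma nat_near_ge (c : R) : \forall n \near \oo, c <= n%:R.
Proof.
near=> n; rewrite (@le_trans _ _ (Num.truncn c).+1%:R)//.
  by rewrite ltW// truncnS_gt.
by rewrite ler_nat; near: n; exact: nbhs_infty_ge.
Unshelve. all: by end_near. Qed.

(** Multiplying the rates by y2 / y1 > 1 turns time [y1] into [y2], at which about n (u + 2 g)
    survivors are still expected, more than the n u left when the clock is read. *)
Lemma clock_not_late (y1 y2 u g : R) : 0 < y1 -> y1 < y2 -> 0 < u -> u <= 1 ->
  0 < g -> g <= 1 -> laplace F y2 = u + 2 * g -> \forall n \near \oo,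
  perm_prob (@x n)
    [pred s | clock (@x n) s (n - Num.truncn (n%:R * u)) <= y1] <=
  expR (- (g ^+ 2 / 8 * n%:R)).
Proof.
move=> y10 y12 u_gt0 u_le1 g0 g1 y2E.
have y20 : 0 <= y2 by apply/ltW/(lt_trans y10).
pose q := y2 / y1.
have q1 : 1 < q by rewrite ltr_pdivlMr// mul1r.
have g2 : 0 < g / 2 by rewrite divr_gt0.
have u8 : 0 < u / 8 by rewrite divr_gt0.
(* Discarding the items above [K] and passing from the sample to [F] cost g / 2 each, so a margin
   [g] out of 2 g remains; [a] is such that fewer than a quarter of n u items are light. *)
have [K K0 FK] := exists_large_cdf F_pos g2.
have [a a0 Fa] := exists_small_cdf F_pos u8.
near=> n.
have n0 : (0 < n)%N by near: n; exact: nbhs_infty_gt.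
have n0r : (0 : R) < n%:R by rewrite ltr0n.
have close_g : forall b,
    `|empirical_cdf (@x n) b - fine (F `]-oo, b]%classic)| <= g / 2.
  by near: n; exact: cdf_eventually_close.
have close_u : forall b,
    `|empirical_cdf (@x n) b - fine (F `]-oo, b]%classic)| <= u / 8.
  by near: n; exact: cdf_eventually_close.
have large_n : K * (2 + q ^+ 2) <= (q - 1) * (a * (n%:R * u / 2)).
  have -> : (q - 1) * (a * (n%:R * u / 2)) = n%:R * ((q - 1) * (a * (u / 2))).
    by ring.
  rewrite -ler_pdivrMr; first by near: n; exact: nat_near_ge.
  by rewrite !mulr_gt0// subr_gt0.
have [mn mu um] := size_bounds (n := n) u_gt0 u_le1.
apply: (@lower_tail_bound _ _ _ (@x_gt0 n) y1 q K a u g) => //.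
- exact: leq_subr.
- exact: ltW.
- exact: ltW.
- exact: ltW.
- by rewrite subKn.
- by rewrite subKn// -natr1.
- have := close_u a; rewrite ler_norml => /andP[_].
  rewrite empirical_cdfE /empirical_mean => Ha.
  have -> : \sum_i (@x n i <= a)%R%:R =
      \sum_i \1_(`]-oo, a]%classic) (@x n i) :> R.
    by apply: eq_bigr => i _; rewrite indicE mem_setE in_itv.
  move: Fa Ha; move: (\sum_i _) (fine _) => S p Fa.
  rewrite lerBlDr ler_pdivrMr// => Ha.
  have : (u / 8 + p) * n%:R <= (u / 4) * n%:R by rewrite ler_wpM2r//; lra.
  have : 0 < n%:R * u by exact: mulr_gt0.
  by lra.
- have dK : down_closed `]-oo, K]%classic.
    by move=> v w vw /=; rewrite !in_itv/=; exact: le_trans.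
  have := down_sum_close F_pos n0 (@x_gt0 n) close_g y20 dK.
  rewrite ler_norml => /andP[S1 _].
  have sumE : \sum_(i | @x n i <= K) expR (- (q * x i * y1)) =
      \sum_(i | @x n i \in `]-oo, K]%classic) expR (- (x i * y2)) :> R.
    apply: eq_big => i; first by rewrite mem_setE in_itv.
    by move=> _; congr (expR (- _)); rewrite /q; field; rewrite gt_eqF.
  have mA : measurable (`]-oo, K]%classic `&` pos) by exact: measurableI.
  have Ap : `]-oo, K]%classic `&` pos `<=` pos by exact: subIsetr.
  have := tilted_mass_lip F (lexx 0) y20 mA Ap.
  have T0_gt : 1 - g / 2 < tilted_mass F 0 (`]-oo, K]%classic `&` pos).
    rewrite tilted_mass0// (_ : _ `&` _ = `]0, K]%classic)//.
    by apply/seteqP; split => v /=; rewrite !in_itv/= andbT;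
      [move=> [-> ->]|move=> /andP[-> ->]].
  move: T0_gt S1; rewrite laplace0// y2E sumE.
  set T0 := tilted_mass _ 0 _; set T2 := tilted_mass _ y2 _.
  set S := \sum_(i | _) _; move: T0 T2 S => T0 T2 S T0_gt S1 T2_ge.
  have : n%:R * (u + g) <= n%:R * (T2 - g / 2) by rewrite ler_wpM2l//; lra.
  by lra.
Unshelve. all: by end_near. Qed.

Lemma perm_prob_rest_far (e u : R) : 0 < e -> 0 < u -> u <= 1 ->
  exists2 c : R, 0 < c & \forall n \near \oo,
    perm_prob (@x n) [pred s | `[< ~ rest_close e u s >]] <=
    (n.*2 + 3)%:R * expR (- (c * n%:R)).
Proof.
(* [kept_close] with both errors equal to [e1] gives 4 n e1 + 1, at most 5 n e1 for large n; the 8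
   leaves room, and the minimum gives e1 <= 1. *)
move=> e_gt0 u_gt0 u_le1; pose e1 := Num.min e 1 / 8.
have m0 : 0 < Num.min e 1 by rewrite lt_min e_gt0 ltr01.
have m1 : Num.min e 1 <= 1 by rewrite ge_min lexx orbT.
have me : Num.min e 1 <= e by rewrite ge_min lexx.
have e10 : 0 < e1 by rewrite /e1; lra.
have e11 : e1 <= 1 by rewrite /e1; lra.
have e1e : 8 * e1 <= e by rewrite /e1; lra.
clearbody e1; clear m0 m1 me.
have [ue|ue] := leP (1 - u) e1.
  exists 1 => //; near=> n.
  have n0 : (0 < n)%N by near: n; exact: nbhs_infty_gt.
  have ne : 1 <= n%:R * e1.
    by rewrite -ler_pdivrMr// div1r; near: n; exact: nat_near_ge.
  have close_n : forall a,
      `|empirical_cdf (@x n) a - fine (F `]-oo, a]%classic)| <= e1.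
    by near: n; exact: cdf_eventually_close.
  rewrite /perm_prob big1 ?mulr_ge0 ?expR_ge0// => s /asboolP.
  case=> D dD; have := @kept_close_trivial _ F F_pos n (@x n) n0 (@x_gt0 n) e1
    close_n u s u_gt0 u_le1 e1 D dD ue.
  move=> /le_trans; apply.
  have : n%:R * (8 * e1) <= n%:R * e by rewrite ler_wpM2l.
  by nra.
have ue1 : u + e1 <= 1 by lra.
have ue2 : u + e1 / 2 <= 1 by lra.
have ue10 : 0 < u + e1 by lra.
have ue20 : 0 < u + e1 / 2 by lra.
(* Survivors are counted at [y1]; the later time [y2], whose Laplace value still exceeds [u],
   provides the margin showing that the clock has passed [y1]. *)
have [y10 y1E] := laplace_invP F_pos ue10 ue1.
have [y20 y2E] := laplace_invP F_pos ue20 ue2.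
move: (laplace_inv F (u + e1)) (laplace_inv F (u + e1 / 2)) y10 y1E y20 y2E.
move=> y1 y2 y10 y1E y20 y2E.
have y12 : y1 < y2.
  by apply: (@laplace_lt_anti _ F _ _ y20); rewrite y1E y2E; lra.
have y1_gt0 : 0 < y1.
  rewrite lt_neqAle y10 andbT; apply/negP => /eqP y1z.
  by move: y1E; rewrite -y1z laplace0//; lra.
have g0 : 0 < e1 / 4 by lra.
have g1 : e1 / 4 <= 1 by lra.
have {}y2E : laplace F y2 = u + 2 * (e1 / 4) by rewrite y2E; lra.
have late := clock_not_late y1_gt0 y12 u_gt0 u_le1 g0 g1 y2E.
pose c := (e1 / 4) ^+ 2 / 8.
have c0 : 0 < c by rewrite divr_gt0// exprn_gt0.
have ce : c <= e1 ^+ 2 / 8 by rewrite /c; nra.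
exists c => //; near=> n.
have n0 : (0 < n)%N by near: n; exact: nbhs_infty_gt.
have ne : 1 <= n%:R * e1.
  by rewrite -ler_pdivrMr// div1r; near: n; exact: nat_near_ge.
have close_n : forall a,
    `|empirical_cdf (@x n) a - fine (F `]-oo, a]%classic)| <= e1.
  by near: n; exact: cdf_eventually_close.
have late_n : perm_prob (@x n)
    [pred s | clock (@x n) s (n - Num.truncn (n%:R * u)) <= y1] <=
    expR (- (c * n%:R)) by near: n.
move: late_n; set k := (n - Num.truncn (n%:R * u))%N => late_n.
pose up (t : option 'I_n * bool) : pred 'S_n :=
  [pred s | (y1 <= clock (@x n) s k) &&
   (\sum_(i | trace (@x n) t i) expR (- (x i * y1)) + n%:R * e1 <=
     kept (trace (@x n) t) s k)].
have union := @perm_prob_union R n (@x n) _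
  [pred s | `[< ~ rest_close e u s >]] [pred s | clock (@x n) s k <= y1]
  up (@x_gt0 n).
apply: le_trans (union _) _.
  move=> s /asboolP/existsNP[D /not_implyP[dD far]].
  have [|y1k] := leP (clock (@x n) s k) y1; first by left.
  right; apply: contrapT => /forallNP not_up; apply: far.
  have le_kept t : kept (trace (@x n) t) s k <=
     \sum_(i | trace (@x n) t i) expR (- (x i * y1)) + n%:R * e1.
    have /negP := not_up t; rewrite /up/= (ltW y1k)/= -ltNge.
    exact: ltW.
  apply: le_trans (kept_close F_pos n0 (@x_gt0 n) close_n u_gt0 u_le1 y10 dD
    y1E e10 le_kept) _.
  have : n%:R * (8 * e1) <= n%:R * e by rewrite ler_wpM2l.
  by nra.
(* There are 2 n + 3 failure events: a late clock, and one for each of the n + 1 traces and of their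
   complements. *)
apply: (@le_trans _ _ (expR (- (c * n%:R)) +
    \sum_(t : option 'I_n * bool) expR (- (c * n%:R)))).
  apply: lerD => //; apply: ler_sum => t _.
  apply: le_trans (upper_tail_bound _ _ _ _ _ _) _ => //; first exact: leq_subr.
  by rewrite ler_expR lerN2 ler_wpM2r.
rewrite sumr_const card_prod card_option card_ord card_bool -mulrS.
rewrite -[leLHS]mulr_natl ler_wpM2r ?expR_ge0// ler_nat.
by rewrite muln2 doubleS !addnS addn0.
Unshelve. all: by end_near. Qed.

End Concentration.

(** * Almost sure and uniform convergence *)

Section BorelCantelli.
Context {R : realType}.

Lemma linear_expRN_geometric (c : R) : 0 < c -> exists C q : R,
  [/\ 0 <= C, 0 < q, q < 1 & forall n : nat,
      (n.*2 + 3)%:R * expR (- (c * n%:R)) <= C * q ^+ n].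
Proof.
(* Half of the exponent absorbs the linear factor, since (3 + 4 / c) (1 + c n / 2) >= 2 n + 3 and 1
   + t <= exp t. *)
move=> c0; exists (3 + 4 / c), (expR (- (c / 2))); split.
- by rewrite addr_ge0// divr_ge0// ltW.
- exact: expR_gt0.
- by rewrite expR_lt1 oppr_lt0 divr_gt0.
move=> n; rewrite -expRM_natr.
have -> : expR (- (c * n%:R)) =
    expR (- (c / 2) * n%:R) * expR (- (c / 2) * n%:R).
  by rewrite -expRD; congr expR; field.
rewrite mulrA ler_wpM2r ?expR_ge0// mulNr expRN ler_pdivrMr ?expR_gt0//.
apply: (@le_trans _ _ ((3 + 4 / c) * (1 + c / 2 * n%:R))); last first.
  by rewrite ler_wpM2l ?expR_ge1Dx// addr_ge0// divr_ge0// ltW.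
have -> : (3 + 4 / c) * (1 + c / 2 * n%:R) =
    3 + 4 / c + 3 * (c / 2 * n%:R) + 2 * n%:R by field; rewrite gt_eqF.
rewrite natrD -mul2n natrM.
have : 0 <= 4 / c by rewrite divr_ge0// ltW.
have : 0 <= c / 2 * n%:R by rewrite mulr_ge0// divr_ge0// ltW.
by lra.
Qed.

Lemma geometric_sum_le (C q : R) n : 0 <= C -> 0 < q -> q < 1 ->
  \sum_(0 <= k < n) C * q ^+ k <= C / (1 - q).
Proof.
move=> C0 q0 q1; have q1' : 0 < 1 - q by rewrite subr_gt0.
rewrite -mulr_sumr ler_wpM2l// -[leRHS]mul1r ler_pdivlMr// big_mkord.
by rewrite mulrC -opprB mulNr -subrX1 opprB lerBlDr lerDl exprn_ge0// ltW.
Qed.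

Lemma borel_cantelli_geometric d (Omega : measurableType d)
    (P : probability Omega R) (B : (set Omega)^nat) (C q : R) N :
  0 <= C -> 0 < q -> q < 1 ->
  (forall n, (N <= n)%N -> measurable (B n)) ->
  (forall n, (N <= n)%N -> (P (B n) <= (C * q ^+ n)%:E)%E) ->
  {ae P, forall w, \forall n \near \oo, ~ B n w}.
Proof.
move=> C0 q0 q1 mB PB; pose D k := B (k + N)%N.
have mD k : measurable (D k) by apply: mB; exact: leq_addl.
exists (lim_sup_set D); split.
- rewrite /lim_sup_set; apply: bigcap_measurable => // k _.
  by apply: bigcup_measurable => j _.
- apply: lim_sup_set_cvg0 => //.
  apply: (@le_lt_trans _ _ (C / (1 - q))%:E); last exact: ltry.
  apply: lime_le; first exact: is_cvg_nneseries.
  apply: nearW => n; apply: (@le_trans _ _ (\sum_(0 <= k < n) C * q ^+ k)%:E).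
    rewrite -sumEFin; apply: lee_sum => k _.
    apply: le_trans (PB _ (leq_addl _ _)) _; rewrite lee_fin ler_wpM2l//.
    by rewrite exprD ler_piMr ?exprn_ge0 ?exprn_ile1 ?ltW.
  by rewrite lee_fin geometric_sum_le.
- move=> w /= far n _; apply: contrapT => nD; apply: far.
  exists (n + N)%N => // k /= nk Bk; apply: nD.
  exists (k - N)%N.
    by rewrite /= leq_subRL ?(leq_trans (leq_addl n N))// addnC.
  by rewrite /D subnK// (leq_trans (leq_addl n N)).
Qed.

End BorelCantelli.

Section Assembly.
Context {R : realType} (F : probability (measurableTypeR R) R).
Hypothesis F_pos : F `]0 : R, +oo[%classic = 1%E.
Local Notation pos := `]0 : R, +oo[%classic.
Variable x : forall n : nat, 'I_n -> R.
Hypothesis x_gt0 : forall (n : nat) (i : 'I_n), 0 < x i.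
Hypothesis x_cvg :
  ereal_sup [set `|(empirical_cdf (@x n) a)%:E - F `]-oo, a]%classic|%E
               | a in [set: R]] @[n --> \oo] --> 0%E.

Lemma ae_rest_close d (Omega : measurableType d) (P : probability Omega R)
    (sigma : forall n : nat, Omega -> 'S_n) (e u : R) :
  (forall n : nat, (0 < n)%N -> size_biased P (@x n) (sigma n)) ->
  0 < e -> 0 < u -> u <= 1 ->
  {ae P, forall w, \forall n \near \oo, rest_close F x e u (sigma n w)}.
Proof.
move=> sb e0 u0 u1.
have [c c0 [N _ PN]] := perm_prob_rest_far F_pos x_gt0 x_cvg e0 u0 u1.
have [C [q [C0 q0 q1 Cq]]] := linear_expRN_geometric c0.
pose B n := [set w | [pred s | `[< ~ rest_close F x e u s >]] (sigma n w)].
(* Starting at [N.+1] ensures n > 0, as the law of [sigma n] is only given there. *)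
have B_prob n : (N.+1 <= n)%N ->
    measurable (B n) /\ (P (B n) <= (C * q ^+ n)%:E)%E.
  move=> Nn; have n0 : (0 < n)%N by exact: leq_trans Nn.
  split; first exact: measurable_perm_event (sb n n0) _.
  apply: le_trans (perm_event_le (x_gt0 (n := n)) (sb n n0) _) _.
  by rewrite lee_fin (le_trans _ (Cq n))// PN//= ltnW.
have := @borel_cantelli_geometric _ _ _ P B C q N.+1 C0 q0 q1
  (fun n Nn => (B_prob n Nn).1) (fun n Nn => (B_prob n Nn).2).
apply: filterS => w; apply: filterS => n /= nB.
by apply: contrapT => far; apply: nB; exact/asboolP.
Qed.

End Assembly.

(** * From a grid of proportions and initial segments to all proportions and intervals *)

Section RealBounds.
Context {R : realType}.

Lemma sandwich_close (n h r k k0 k1 t t0 t1 : R) : 0 <= n ->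
  k0 <= k -> k <= k1 -> t <= t0 + r -> t1 <= t + r ->
  `|k0 - n * t0| <= n * h -> `|k1 - n * t1| <= n * h ->
  `|k - n * t| <= n * (h + r).
Proof.
move=> n0 k0k kk1 /(ler_wpM2l n0) + /(ler_wpM2l n0).
rewrite !mulrDr !ler_norml => t0r t1r /andP[? ?] /andP[? ?].
by apply/andP; split; lra.
Qed.

Lemma difference_close (n h k k' t t' : R) :
  `|k - n * t| <= n * h -> `|k + k' - n * (t + t')| <= n * h ->
  `|k' - n * t'| <= n * (2 * h).
Proof.
rewrite !mulrDr !ler_norml => /andP[? ?] /andP[? ?].
by apply/andP; split; lra.
Qed.

End RealBounds.

Section Intervals.
Context {R : realType} (F : probability (measurableTypeR R) R).
Hypothesis F_pos : F `]0 : R, +oo[%classic = 1%E.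
Local Notation pos := `]0 : R, +oo[%classic.

Lemma tiltedE (u : R) (A : set R) : 0 < u -> u <= 1 -> measurable A ->
  A `<=` pos ->
  tilted F u A = (tilted_rest F u A / u)%:E.
Proof.
move=> u0 u1 mA Ap; have [y0 _] := laplace_invP F_pos u0 u1.
have int_e := integrable_expRNM F y0 mA Ap.
rewrite /tilted /tilted_rest (setIidl Ap) EFinM muleC.
rewrite [X in (_ * X)%E]fineK; last exact: integrable_fin_num int_e.
rewrite -integralZl//; apply: eq_integral => z _.
by rewrite -EFinM mulrC [z * _]mulrC.
Qed.

Lemma down_closed_Nyitv (b : itv_bound R) : down_closed [set` Interval -oo%O b].
Proof.
move=> v w vw /=; rewrite !itv_boundlr /= => wb.
by apply: le_trans wb; rewrite bnd_simp.
Qed.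

Section FixedSize.
Context {n : nat} (x : 'I_n -> R) (s : 'S_n).

Lemma tail_empiricalE (u : R) (A : set R) : 0 <= u -> u <= 1 ->
  tail_empirical (permuted_seq x s) u A =
  kept (fun i => x i \in A) s (n - Num.truncn (n%:R * u)) /
  (Num.truncn (n%:R * u))%:R.
Proof.
move=> u0 u1.
have sz : size (permuted_seq x s) = n by rewrite size_map size_enum_ord.
rewrite /tail_empirical /empirical_dist /last_terms sz.
set m := Num.truncn _; have mn : (m <= n)%N.
  rewrite -(ler_nat R) (@le_trans _ _ (n%:R * u))//.
    by rewrite truncn_le mulr_ge0.
  by rewrite ler_piMr.
rewrite size_drop sz subKn//; congr (_ / _).
rewrite /permuted_seq -map_drop count_map.
have -> : drop (n - m) (enum 'I_n) =
    [seq l : 'I_n <- enum 'I_n | (n - m <= l)%N].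
  apply: (inj_map val_inj); rewrite map_drop val_enum_ord drop_iota add0n.
  rewrite -(filter_map val (leq (n - m))) val_enum_ord.
  rewrite -[X in iota 0 X](subnKC (leq_subr m n)) iotaD filter_cat add0n.
  rewrite (eq_in_filter (a2 := pred0)) => [|i]; last first.
    by rewrite mem_iota add0n /= => ik; apply/negbTE; rewrite -ltnNge.
  rewrite filter_pred0 cat0s; apply/esym/all_filterP/allP => i.
  by rewrite mem_iota => /andP[].
rewrite count_filter -sum1_count natr_sum big_enum_cond/= /kept.
rewrite big_mkcondl/=; apply: eq_bigr => l _.
by case: ifP.
Qed.

Variable h : R.
Variable M : nat.
Hypotheses (M_gt0 : (0 < M)%N) (n_gt0 : (0 < n)%N).
Hypothesis grid_close : forall i, (0 < i)%N -> (i <= M)%N ->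
  forall D, down_closed D ->
  `|kept (fun i => x i \in D) s (n - Num.truncn (n%:R * (i%:R / M%:R) : R)) -
    n%:R * tilted_rest F (i%:R / M%:R) D| <= n%:R * h.

Lemma kept_down_close (u : R) (D : set R) : M%:R^-1 <= u -> u <= 1 ->
  down_closed D ->
  `|kept (fun i => x i \in D) s (n - Num.truncn (n%:R * u)) -
    n%:R * tilted_rest F u D| <= n%:R * (h + M%:R^-1).
Proof.
move=> Mu u1 dD; have M0 : (0 : R) < M%:R by rewrite ltr0n.
have n0 : (0 : R) < n%:R by rewrite ltr0n.
have mD := down_closed_measurable dD.
have u0 : 0 < u by apply: lt_le_trans Mu; rewrite invr_gt0.
(* Neighbouring grid points around [u]: the minimum handles u = 1, and u >= 1/M makes [i] positive.
   Survivor counts and tilted masses are both monotone in the proportion. *)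
pose i := Num.truncn (M%:R * u); pose j := minn i.+1 M.
have Mu0 : 0 <= M%:R * u by rewrite mulr_ge0// ltW.
have /andP[iu ui] := truncn_itv Mu0; rewrite -/i in iu ui.
have i0 : (0 < i)%N by rewrite truncn_gt0 -ler_pdivrMl// mulr1.
have iM : (i <= M)%N by rewrite -(ler_nat R) (le_trans iu)// ler_piMr// ltW.
have j0 : (0 < j)%N by rewrite leq_min.
have jM : (j <= M)%N by rewrite geq_minr.
set v0 := i%:R / M%:R : R; set v1 := j%:R / M%:R : R.
have v0u : v0 <= u by rewrite ler_pdivrMr// mulrC.
have uv1 : u <= v1.
  rewrite ler_pdivlMr// mulrC /j; have [_|_] := leqP i.+1 M; first exact: ltW.
  by rewrite ler_piMr// ltW.
have v00 : 0 < v0 by rewrite divr_gt0// ltr0n.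
have v11 : v1 <= 1 by rewrite ler_pdivrMr// mul1r ler_nat.
have v10 : v1 - v0 <= M%:R^-1.
  rewrite -mulrBl ler_pdivrMr// mulVf ?gt_eqF// lerBlDl natr1 ler_nat.
  by rewrite geq_minl.
have le_m (v w : R) : v <= w ->
    (n - Num.truncn (n%:R * w) <= n - Num.truncn (n%:R * v))%N.
  by move=> vw; rewrite leq_sub2l// le_truncn// ler_wpM2l.
have k0 := @kept_anti R n (fun i => x i \in D) s _ _ (le_m _ _ v0u).
have k1 := @kept_anti R n (fun i => x i \in D) s _ _ (le_m _ _ uv1).
have /andP[_ t1] := tilted_rest_lip F_pos mD v00 v0u u1.
have /andP[_ t2] := tilted_rest_lip F_pos mD u0 uv1 v11.
apply: (sandwich_close _ k0 k1 _ _ (grid_close i0 iM dD) (grid_close j0 jM dD)).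
- exact: ltW.
- by rewrite (le_trans t1)// lerD2l (le_trans _ v10)// lerD2r.
- by rewrite (le_trans t2)// lerD2l (le_trans _ v10)// lerD2l lerN2.
Qed.

(** An interval is the difference of two initial segments, hence the factor 2. *)
Lemma kept_itv_close (u : R) (I : interval R) : M%:R^-1 <= u -> u <= 1 ->
  [set` I] `<=` pos ->
  `|kept (fun i => x i \in [set` I]) s (n - Num.truncn (n%:R * u)) -
    n%:R * tilted_rest F u [set` I]| <= n%:R * (2 * (h + M%:R^-1)).
Proof.
move=> Mu u1 Ip; have M0 : (0 : R) < M%:R by rewrite ltr0n.
have u0 : 0 < u by apply: lt_le_trans Mu; rewrite invr_gt0.
have [y0 _] := laplace_invP F_pos u0 u1.
case: I Ip => l r Ip; set k := (n - _)%N.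
have dl := kept_down_close Mu u1 (@down_closed_Nyitv l).
have dr := kept_down_close Mu u1 (@down_closed_Nyitv r).
have [lr|rl] := leP l r; last first.
  rewrite set_itv_ge; last by rewrite -leNgt ltW.
  rewrite /kept big1 => [|i _]; last by rewrite in_set0.
  rewrite /tilted_rest set0I /tilted_mass Rintegral_set0 mulr0 subr0 normr0.
  have n0 : (0 : R) < n%:R by rewrite ltr0n.
  have : 0 <= n%:R * (h + M%:R^-1) by exact: le_trans dl.
  by rewrite !pmulr_rge0.
have U := itv_bndbnd_setU (isT : (-oo <= l)%O) lr.
have disj : [disjoint [set` Interval -oo%O l] & [set` Interval l r]].
  apply/disj_setPS => z [] /=; rewrite !itv_boundlr => /andP[_ zl] /andP[lz _].
  by have := le_trans zl lz; rewrite bnd_simp ltxx.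
have keptU : kept (fun i => x i \in [set` Interval -oo%O r]) s k =
    kept (fun i => x i \in [set` Interval -oo%O l]) s k +
    kept (fun i => x i \in [set` Interval l r]) s k :> R.
  rewrite /kept -big_split/=; apply: eq_bigr => i _.
  rewrite U in_setU; case: (boolP (x (s i) \in [set` Interval -oo%O l])) => //=.
    move=> /set_mem il; case: (boolP (x (s i) \in [set` Interval l r])) => /=.
      move=> /set_mem ilr.
      by have /disj_setPS/(_ (x (s i)) (conj il ilr)) := disj.
    by rewrite addr0.
  by rewrite add0r.
have restU : tilted_rest F u [set` Interval -oo%O r] =
    tilted_rest F u [set` Interval -oo%O l] +
    tilted_rest F u [set` Interval l r].
  rewrite /tilted_rest U setIUl tilted_massU//.
  - by apply: measurableI => //; exact: measurable_itv.
  - by apply: measurableI => //; exact: measurable_itv.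
  - apply/disj_setPS => z [[a _] [b _]].
    by have /disj_setPS/(_ z) := disj; apply.
by rewrite keptU restU in dr; exact: difference_close dl dr.
Qed.

Lemma tail_empirical_close (delta u : R) (I : interval R) :
  0 < delta -> M%:R^-1 <= delta -> 1 <= n%:R * delta -> delta <= u -> u <= 1 ->
  [set` I] `<=` pos ->
  (`|(tail_empirical (permuted_seq x s) u [set` I])%:E - tilted F u [set` I]| <=
  ((2 * (h + M%:R^-1) + n%:R^-1) / delta)%:E)%E.
Proof.
move=> d0 Md nd du u1 Ip; have u0 : 0 < u by exact: lt_le_trans du.
have n0 : (0 : R) < n%:R by rewrite ltr0n.
rewrite tiltedE// tail_empiricalE ?(ltW u0)//.
have [mn mu um] := size_bounds (n := n) u0 u1.
have := kept_itv_close (le_trans Md du) u1 Ip.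
have := @kept_le R n (fun i => x i \in [set` I]) s
  (n - Num.truncn (n%:R * u)).
rewrite subKn//.
have := @kept_ge0 R n (fun i => x i \in [set` I]) s
  (n - Num.truncn (n%:R * u)).
move: (kept _ _ _) => p p0.
have m0 : (0 < Num.truncn (n%:R * u))%N.
  by rewrite truncn_gt0 (le_trans nd)// ler_wpM2l// ltW.
have m0r : (0 : R) < (Num.truncn (n%:R * u))%:R by rewrite ltr0n.
move: (Num.truncn _)%:R m0r mu um => m m0r mu um.
move: (tilted_rest _ _ _) => T pm close.
rewrite -EFinB lee_fin.
(* The first term compares the unnormalised quantities; the second corrects for dividing by [m]
   instead of n u and is at most 1 / (n u). *)
have -> : p / m - T / u =
    (p - n%:R * T) / (n%:R * u) + p / m * ((n%:R * u - m) / (n%:R * u)).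
  by field; rewrite !gt_eqF.
have nu0 : 0 < n%:R * u by exact: mulr_gt0.
have n1 : 0 <= (n%:R * u - m) / (n%:R * u) <= n%:R^-1 / u.
  rewrite divr_ge0 ?subr_ge0 ?(ltW nu0)//= -invfM -[leRHS]mul1r.
  by rewrite ler_wpM2r ?invr_ge0 ?(ltW nu0)//; lra.
have pm1 : 0 <= p / m <= 1.
  by rewrite divr_ge0 ?(ltW m0r)//= ler_pdivrMr// mul1r.
have prod_le : `|p / m * ((n%:R * u - m) / (n%:R * u))| <= n%:R^-1 / u.
  case/andP: n1 => a1 a2; case/andP: pm1 => b1 b2.
  rewrite ger0_norm; last exact: mulr_ge0.
  by apply: le_trans a2; rewrite ler_piMl.
have quot_le : `|(p - n%:R * T) / (n%:R * u)| <= 2 * (h + M%:R^-1) / u.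
  rewrite normrM [X in _ * X]gtr0_norm ?invr_gt0// ler_pdivrMr//.
  apply: le_trans close _; rewrite le_eqVlt; apply/orP; left; apply/eqP.
  by field; rewrite !gt_eqF// ltr0n.
have h0 : 0 <= 2 * (h + M%:R^-1).
  by have := le_trans (normr_ge0 _) close; rewrite pmulr_rge0.
apply: le_trans (ler_normD _ _) _; apply: le_trans (lerD quot_le prod_le) _.
rewrite -mulrDl ler_wpM2l ?addr_ge0 ?invr_ge0 ?(ltW n0)//.
by rewrite lef_pV2.
Qed.

End FixedSize.
End Intervals.

Theorem theorem23 (R : realType)
    (d : measure_display) (Omega : measurableType d) (P : probability Omega R)
    (x : forall n : nat, 'I_n -> R)
    (F : probability (measurableTypeR R) R)
    (sigma : forall n : nat, Omega -> 'S_n)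
    (x_gt0 : forall (n : nat) (i : 'I_n), 0 < x n i)
    (F_gt0 : F `]0, +oo[%classic = 1%E)
    (x_cvg : ereal_sup [set `|(empirical_cdf (x n) a)%:E - F `]-oo, a]%classic|%E
               | a in [set: R]] @[n --> \oo] --> 0%E)
    (sigma_sb : forall n : nat, (0 < n)%N -> size_biased P (x n) (sigma n))
    (delta : R) (delta_gt0 : 0 < delta) (delta_lt1 : delta < 1) :
  {ae P, forall w : Omega,
    ereal_sup [set
      ereal_sup [set
        `|(tail_empirical (permuted_seq (x n) (sigma n w)) u [set` I])%:E
          - tilted F u [set` I]|%E
        | I in [set I : interval R | [set` I] `<=` `]0, +oo[]]
      | u in `[delta, 1]] @[n --> \oo] --> 0%E}.
Proof.
(* A single null set serves all grids: the pairs (p, i) are countable, and both the mesh and the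
   error at level [p] are 1/(p+1). *)
have close_ae : {ae P, forall w, forall p i : nat, (0 < i)%N -> (i <= p.+1)%N ->
    \forall n \near \oo,
      rest_close F x (p.+1%:R^-1) (i%:R / p.+1%:R) (sigma n w)}.
  apply: ae_foralln => p; apply: ae_foralln => i.
  have [/andP[i0 ip]|nip] := boolP ((0 < i)%N && (i <= p.+1)%N); last first.
    by apply: aeW => w i0 ip; rewrite i0 ip in nip.
  have := ae_rest_close F_gt0 x_gt0 x_cvg (e := p.+1%:R^-1)
    (u := i%:R / p.+1%:R) sigma_sb.
  rewrite invr_gt0 ltr0n divr_gt0 ?ltr0n// ler_pdivrMr ?ltr0n// mul1r ler_nat.
  by move=> /(_ isT isT ip); apply: filterS.
apply: filterS close_ae => w close_w.
set S := fun n => ereal_sup _.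
have bound (eta : R) : 0 < eta ->
    \forall n \near \oo, (0 <= S n)%E /\ (S n <= eta%:E)%E.
  move=> eta0; have etad : 0 < eta * delta by exact: mulr_gt0.
  (* The final error is (2 (h + 1/M) + 1/n) / delta with h = 1/M = 1/(p+1) and 1/n <= 1/(p+1), hence
     the 5; the other summand puts the mesh below [delta]. *)
  pose p := Num.truncn (5 / (eta * delta) + delta^-1).
  have p_gt : 5 / (eta * delta) + delta^-1 < p.+1%:R by exact: truncnS_gt.
  have p0 : (0 : R) < p.+1%:R by rewrite ltr0n.
  have q0 : 0 < 5 / (eta * delta) by rewrite divr_gt0.
  have di0 : 0 < delta^-1 by rewrite invr_gt0.
  have pd : p.+1%:R^-1 <= delta.
    by rewrite -[leRHS]invrK lef_pV2 ?posrE//; lra.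
  have pe : 5 * p.+1%:R^-1 <= eta * delta.
    rewrite ler_pdivrMr// mulrC -ler_pdivrMr//; lra.
  have close_p : \forall n \near \oo, forall i : 'I_p.+1,
      rest_close F x (p.+1%:R^-1) (i.+1%:R / p.+1%:R) (sigma n w).
    by apply: filter_forall => i; apply: close_w.
  near=> n.
  have n_gt0 : (0 < n)%N by near: n; exact: nbhs_infty_gt.
  have n_ge : p.+1%:R <= n%:R :> R by near: n; exact: nat_near_ge.
  have close_n : forall i : 'I_p.+1,
      rest_close F x (p.+1%:R^-1) (i.+1%:R / p.+1%:R) (sigma n w).
    by near: n.
  have n_inv : n%:R^-1 <= p.+1%:R^-1 :> R by rewrite lef_pV2 ?posrE// ltr0n.
  have nd : 1 <= n%:R * delta.
    rewrite -ler_pdivrMr// mul1r (le_trans _ n_ge)//; lra.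
  split.
    (* The supremum of an empty set would be -oo, so nonnegativity needs a witness in each supremum:
       u = 1 and an empty interval. *)
    have one_mem : [set` `[delta, 1]] (1 : R) by rewrite /= in_itv/= lexx ltW.
    have empty_pos : [set` `]1 : R, 0[] `<=` `]0 : R, +oo[.
      by move=> z /=; rewrite !in_itv/= => /andP[z1 z0]; lra.
    apply: le_trans (ereal_sup_ubound (ex_intro2 _ _ 1 one_mem erefl)).
    apply: le_trans (ereal_sup_ubound (ex_intro2 _ _ `]1, 0[ empty_pos erefl)).
    exact: abse_ge0.
  apply: ge_ereal_sup => _ [u /= + <-]; rewrite in_itv/= => /andP[du u1].
  apply: ge_ereal_sup => _ [I /= Ip <-].
  have grid i : (0 < i)%N -> (i <= p.+1)%N ->
      rest_close F x (p.+1%:R^-1) (i%:R / p.+1%:R) (sigma n w).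
    by case: i => // i _ ip; exact: (close_n (Ordinal ip)).
  apply: le_trans (tail_empirical_close F_gt0 (ltn0Sn p) n_gt0 grid delta_gt0
    pd nd du u1 Ip) _.
  rewrite lee_fin ler_pdivrMr// (le_trans _ pe)//.
  have -> : 5 * p.+1%:R^-1 =
      2 * (p.+1%:R^-1 + p.+1%:R^-1) + p.+1%:R^-1 :> R by ring.
  by rewrite lerD2l.
apply/fine_cvgP; split.
  have := bound 1 ltr01; apply: filterS => n [S0 S1].
  by rewrite ge0_fin_numE// (le_lt_trans S1)// ltry.
apply/cvgr0Pnorm_le => eta eta0; have := bound eta eta0.
apply: filterS => n [S0 S1] /=.
rewrite ger0_norm ?fine_ge0// -lee_fin fineK//.
by rewrite ge0_fin_numE// (le_lt_trans S1)// ltry.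
Unshelve. all: by end_near. Qed.
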